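(* Say that an equation $F(\alpha_1,\dots,\alpha_n)=c$ (with $F$ a signed sum of products of powers of fixed integers, unknowns $\alpha_i$ non-negative integers) satisfies the Hasse-type property if either it has a solution in non-negative integers, or there exists an integer $m\ge 2$ such that the congruence $F(\alpha_1,\dots,\alpha_n)\equiv c\pmod m$ has no solution in non-negative integers. Then, for every integer $c$ with $0\le c\le 1000$, the Hasse-type property holds for each of the following equations in non-negative integer unknowns: (1) $p_1^{\alpha_1}-p_2^{\alpha_2}=c$ and $p_1^{\alpha_1}+p_2^{\alpha_2}-p_3^{\alpha_3}=c$, where $p_1,p_2,p_3$ are distinct primes less than $100$; (2) $p_1^{\alpha_1}+\dots+p_{t-1}^{\alpha_{t-1}}-p_t^{\alpha_t}=c$, where $4\le t\le 8$ and $p_1<\dots<p_t$ are primes less than $30$; (3) $p_1^{\alpha_1}p_2^{\alpha_2}+p_3^{\alpha_3}p_4^{\alpha_4}-p_5^{\alpha_5}p_6^{\alpha_6}=c$, where $p_1,\dots,p_6$ are the primes $2,3,5,7,11,13$ in some order. Moreover, (4) the equation $2^{\alpha_1}+3^{\alpha_2}+5^{\alpha_3}+7^{\alpha_4}+11^{\alpha_5}+13^{\alpha_6}+17^{\alpha_7}+19^{\alpha_8}-23^{\alpha_9}=55191$ satisfies the Hasse-type property.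
   Context: All unknowns $\alpha_i$ range over non-negative integers. *)

(* Defs.v *)
From mathcomp Require Import all_boot all_order all_algebra.
Set Implicit Arguments. Unset Strict Implicit. Unset Printing Implicit Defensive.
Import Order.TTheory GRing.Theory Num.Theory.

(* Unknowns: a : nat -> nat, a i = alpha_{i+1}; only finitely many are used by
   each equation, so existence over nat -> nat is the same as over N^n. *)
Definition unknowns := nat -> nat.

Definition hasse_prop (F : unknowns -> int) (c : int) : Prop :=
  (exists a : unknowns, F a = c) \/
  (exists m : nat, (2 <= m)%N /\
     forall a : unknowns, ~ (F a = c %[mod (m%:Z)])%Z).

Definition zpow (p e : nat) : int := Posz (p ^ e)%N.

(* Main.v *)
Require Import Defs.
From Stdlib Require Import NArith ZArith Lia List Strings.Byte Bool Arith Znumtheory.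
From Stdlib Require Sorted.
From mathcomp Require Import ssreflect ssrfun ssrbool.
Set Implicit Arguments. Unset Strict Implicit. Unset Printing Implicit Defensive.
Set Asymmetric Patterns.
Import ListNotations.
Local Open Scope list_scope.

(** Only finitely many equations are concerned, and each is settled by a verified computation:
    either a solution is exhibited, or one modulus is shown to exclude all solutions. The search
    data (witness lists, choice of moduli) need no justification beyond the success of the checks;
    what has to be proved is that the checks are sound.

    The excluding modulus is usually the product of the eighteen entries of [chain]. The exponents
    of their unit groups all divide 1440, and modulo each of them p^(e+1440) = p^e for e >= 5, so
    the exponents below [horizon] = 1445 represent every power of p ([reduce_exponent],
    [tree_of_cov]). The product is far too large for an enumeration of residues, so the congruence
    is refined one factor at a time. The residue vectors of the powers of p form a trie with one
    level per modulus. A signed sum is cut into two halves; at each level the choices of branches on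
    one side are put in buckets by residue, those on the other side are matched with them, and each
    matching combination is examined modulo the next entry. If no combination reaches the end of the
    chain, the congruences are incompatible. Conversely, exponents satisfying all the congruences
    would trace a combination surviving every level: this is [sieve_sound]. Products of two powers
    are handled by tries whose levels are multiplied out on demand.

    Calls to the sieve are kept few in three ways. For one or two added powers, the modulus 65520,
    under which every prime has few powers, already excludes most [c] ([decided_settled]). For
    longer sums, an obstruction for a set of primes enlarged by p, at the right-hand side c + p^e,
    gives one for the smaller set at c, by fixing the exponent of p to be e ([obstructed_insert]);
    so the sets are treated from the largest down ([descend_settled]). For products, the symmetries
    of the equation reduce the 720 orders of the six primes to 45 pairings ([canonical_settled]). *)

(** * Bytes as residues, and buckets indexed by bytes *)

Inductive quad (A : Type) := Quad (a0 a1 a2 a3 : A).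
Inductive digit := d0 | d1 | d2 | d3.
Definition sel (A : Type) (i : digit) (t : quad A) : A :=
  match t with Quad a0 a1 a2 a3 => match i with d0 => a0 | d1 => a1 | d2 => a2 | d3 => a3 end end.
Definition upd (A : Type) (f : A -> A) (i : digit) (t : quad A) : quad A :=
  match t with Quad a0 a1 a2 a3 =>
  match i with
  | d0 => Quad (f a0) a1 a2 a3 | d1 => Quad a0 (f a1) a2 a3
  | d2 => Quad a0 a1 (f a2) a3 | d3 => Quad a0 a1 a2 (f a3)
  end end.
Definition dig (b0 b1 : bool) := if b0 then if b1 then d3 else d1 else if b1 then d2 else d0.
Definition digits (b : byte) : digit * digit * digit * digit :=
  let '(b0, (b1, (b2, (b3, (b4, (b5, (b6, b7))))))) := Byte.to_bits b in
  (dig b0 b1, dig b2 b3, dig b4 b5, dig b6 b7).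
Definition fill4 (A : Type) (x : A) : quad A := Quad x x x x.
(** Four levels of four cells: one cell for each of the 256 bytes, addressed by the base-4 digits of
    the byte. *)
Definition bucket (A : Type) := quad (quad (quad (quad (list A)))).
Definition bempty (A : Type) : bucket A := fill4 (fill4 (fill4 (fill4 nil))).
(** A phantom index: it keeps the byte visible in the goal, so that after case analysis each of the
    256 branches can read off its own constructor. *)
Definition at_byte (b : byte) (A : Type) := A.
Definition tabulate (A : Type) (f : byte -> A) (b : byte) : A.
Proof.
change (at_byte b A).
destruct b; match goal with |- at_byte ?k _ => exact (f k) end.
Defined.

(** Evaluated in advance to a 256-way match, so that an access costs one jump and no digit
    arithmetic. *)
Definition bins : forall A : Type, byte -> A -> bucket A -> bucket A := Eval cbv in
  fun A k x b => tabulate (fun k => let '(i0,i1,i2,i3) := digits k in upd (upd (upd (upd (cons x) i0) i1) i2) i3 b) k.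
Definition bfind : forall A : Type, byte -> bucket A -> list A := Eval cbv in
  fun A k b => tabulate (fun k => let '(i0,i1,i2,i3) := digits k in sel i0 (sel i1 (sel i2 (sel i3 b)))) k.

Definition b2n : byte -> N := Byte.to_N.
Definition n2b (n : N) : byte := if Byte.of_N n is Some b then b else x00.

(** Arguments that are not residues give [xff], which is nonzero; hence a vanishing difference
    certifies equality for all bytes, as [stage_ok] checks. *)
Definition table (q : N) (f : N -> N -> N) : byte -> byte -> byte :=
  fun a b => tabulate (fun a =>
    if (b2n a <? q)%N then
      tabulate (fun b => if (b2n b <? q)%N then n2b (f (b2n a) (b2n b) mod q)%N else xff) b
    else xff) a.

Record stage := Stage { modulus : N; badd : byte -> byte -> byte;
  bsub : byte -> byte -> byte; bmul : byte -> byte -> byte }.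

Definition stage_of (q : N) : stage :=
  Stage q (table q N.add) (table q (fun a b => a + q - b)%N) (table q N.mul).

(** * Residue tries and the meet-in-the-middle sieve *)

(** A node is a linked list of children through [Br], each labelled by a residue modulo the current
    stage; [B1], [B2], [B3], [B5] are compact forms of lists of these lengths. [Pr] chains pairs of
    tries whose products have not been multiplied out yet. *)
Inductive tree := Stop | B1 (k1:byte) (u1:tree) | B2 (k1:byte) (u1:tree) (k2:byte) (u2:tree) | B3 (k1:byte) (u1:tree) (k2:byte) (u2:tree)  (k3:byte) (u3:tree)
 | B5 (k1:byte) (u1:tree) (k2:byte) (u2:tree)  (k3:byte) (u3:tree)  (k4:byte) (u4:tree)  (k5:byte) (u5:tree) | Br (k : byte) (sub next : tree) | Pr (u v next : tree).
Inductive terms := TNil | TCons (neg : bool) (t : tree) (r : terms).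

Definition pack (t : tree) : tree :=
  match t with
  | Br k1 u1 Stop => B1 k1 u1
  | Br k1 u1 (Br k2 u2 Stop) => B2 k1 u1 k2 u2
  | Br k1 u1 (Br k2 u2 (Br k3 u3 Stop)) => B3 k1 u1 k2 u2 k3 u3
  | Br k1 u1 (Br k2 u2 (Br k3 u3 (Br k4 u4 (Br k5 u5 Stop)))) => B5 k1 u1 k2 u2 k3 u3 k4 u4 k5 u5
  | _ => t
  end.
Definition isz (b : byte) : bool := if b is x00 then true else false.

(** Pairs whose labels have the same product are gathered under one child as a [Pr] chain, so a
    product trie branches at most once per residue. *)
Fixpoint group (s : stage) (k : byte) (u v acc : tree) : tree :=
  match acc with
  | Br k' w n => if isz (bsub s k k') then Br k' (Pr u v w) n else Br k' w (group s k u v n)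
  | _ => Br k (Pr u v Stop) Stop
  end.

Definition unpack (t : tree) : tree :=
  match t with
  | B1 k1 u1 => Br k1 u1 Stop
  | B2 k1 u1 k2 u2 => Br k1 u1 (Br k2 u2 Stop)
  | B3 k1 u1 k2 u2 k3 u3 => Br k1 u1 (Br k2 u2 (Br k3 u3 Stop))
  | B5 k1 u1 k2 u2 k3 u3 k4 u4 k5 u5 => Br k1 u1 (Br k2 u2 (Br k3 u3 (Br k4 u4 (Br k5 u5 Stop))))
  | _ => t
  end.
Fixpoint products_with (s : stage) (k : byte) (u v acc : tree) : tree :=
  if v is Br k' v' n then products_with s k u n (group s (bmul s k k') u v' acc) else acc.
Fixpoint products (s : stage) (u v acc : tree) : tree :=
  if u is Br k u' n then products s n v (products_with s k u' v acc) else acc.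
Fixpoint expand_products (s : stage) (t : tree) : tree :=
  if t is Pr u v n then products s (unpack u) (unpack v) (expand_products s n) else Stop.
Definition expand (s : stage) (t : tree) : tree :=
  if t is Pr _ _ _ then pack (expand_products s t) else t.

Definition fold_subs (A : Type) (g : byte -> tree -> A -> A) (t : tree) (b : A) : A :=
  match t with
  | B1 k1 u1 => g k1 u1 b
  | B2 k1 u1 k2 u2 => g k1 u1 (g k2 u2 b)
  | B3 k1 u1 k2 u2 k3 u3 => g k1 u1 (g k2 u2 (g k3 u3 b))
  | B5 k1 u1 k2 u2 k3 u3 k4 u4 k5 u5 =>
    g k1 u1 (g k2 u2 (g k3 u3 (g k4 u4 (g k5 u5 b))))
  | t => (fix loop (t : tree) (b : A) {struct t} : A :=
            match t with Br k u n => loop n (g k u b) | _ => b end) t b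
  end.

Definition all_subs (g : byte -> tree -> bool) (t : tree) : bool :=
  match t with
  | B1 k1 u1 => g k1 u1
  | B2 k1 u1 k2 u2 => if g k1 u1 then g k2 u2 else false
  | B3 k1 u1 k2 u2 k3 u3 =>
    if g k1 u1 then if g k2 u2 then g k3 u3 else false else false
  | B5 k1 u1 k2 u2 k3 u3 k4 u4 k5 u5 =>
    if g k1 u1 then if g k2 u2 then if g k3 u3 then if g k4 u4 then g k5 u5
    else false else false else false else false
  | t => (fix loop (t : tree) {struct t} : bool :=
            match t with Br k u n => if g k u then loop n else false | _ => true end) t
  end.

Section Join.
Variables (s : stage) (ad sb : byte -> byte -> byte).
(** The key accumulates the signed residues of the chosen branches, and [path] collects (in reverse
    order) the subtries below them, ready for the next stage. In [scan] the signs are exchanged and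
    the key starts at the residue of the right-hand side, so that two half choices are compatible
    exactly when their keys agree. *)
Fixpoint fill_bucket (ts : terms) (k : byte) (path : terms) (b : bucket terms) {struct ts}
    : bucket terms :=
  match ts with
  | TNil => bins k path b
  | TCons ng t r =>
    let row := (if ng then sb else ad) k in
    let t := match t with Pr _ _ _ => expand s t | _ => t end in
    match r with
    | TNil => fold_subs (fun k' u b => bins (row k') (TCons ng u path) b) t b
    | _ => fold_subs (fun k' u b => fill_bucket r (row k') (TCons ng u path) b) t b
    end
  end.

Variables (f : terms -> terms -> bool) (b : bucket terms).
Fixpoint all_paths (p : terms) (l : list terms) : bool :=
  match l with nil => true | q :: l => if f q p then all_paths p l else false end.
Fixpoint scan (ts : terms) (k : byte) (path : terms) {struct ts} : bool :=
  match ts with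
  | TNil => all_paths path (bfind k b)
  | TCons ng t r =>
    let row := (if ng then ad else sb) k in
    let t := match t with Pr _ _ _ => expand s t | _ => t end in
    match r with
    | TNil => all_subs (fun k' u =>
        match bfind (row k') b with nil => true | l => all_paths (TCons ng u path) l end) t
    | _ => all_subs (fun k' u => scan r (row k') (TCons ng u path)) t
    end
  end.
End Join.

(** The value [true] means that every combination has died; one that survives all moduli meets the
    empty list and yields [false]. *)
Fixpoint sieve (st : list stage) (cs : list byte) (l r : terms) : bool :=
  match st, cs with
  | s :: st, c :: cs =>
    match s with Stage _ ad sb _ =>
      scan s ad sb (sieve st cs) (fill_bucket s ad sb l x00 TNil (bempty terms)) r c TNil
    end
  | _, _ => false
  end.

(** * The chain of moduli and the tries of prime powers *)

Fixpoint residue_pos (s : stage) (n : positive) : byte :=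
  match n with
  | xH => x01
  | xO n => let r := residue_pos s n in badd s r r
  | xI n => let r := residue_pos s n in badd s (badd s r r) x01
  end.
Definition residue (s : stage) (n : N) : byte :=
  if n is Npos n then residue_pos s n else x00.

Fixpoint iterates (A : Type) (f : A -> A) (x : A) (n : nat) : list A :=
  if n is S n then x :: iterates f (f x) n else nil.
Fixpoint vectors (st : list stage) (p : N) (n : nat) : list (list byte) :=
  if st is s :: st then
    map (fun x => fst x :: snd x) (combine (iterates (bmul s (residue s p)) x01 n) (vectors st p n))
  else repeat nil n.

Fixpoint put (s : stage) (k : byte) (v : list byte) (l : list (byte * list (list byte))) :=
  if l is (k', vs) :: l then
    if isz (bsub s k k') then (k', v :: vs) :: l else (k', vs) :: put s k v l
  else [(k, [v])].
Fixpoint classify (s : stage) (vs : list (list byte)) (l : list (byte * list (list byte))) :=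
  match vs with
  | (k :: v) :: vs => classify s vs (put s k v l)
  | _ => l
  end.
Fixpoint build (st : list stage) (vs : list (list byte)) : tree :=
  if st is s :: st then
    pack (fold_right (fun kv t => Br (fst kv) (build st (snd kv)) t) Stop (classify s vs nil))
  else Stop.
Definition prime_tree (st : list stage) (n : nat) (p : N) : tree := build st (vectors st p n).

(** Every unit group has exponent dividing 1440, and the powers of a prime become periodic after at
    most 5 steps (the worst case is 2 modulo 32). All residues fit in a byte. The first four moduli
    have least common multiple 65520. *)
Definition chain : list stage := Eval vm_compute in
  map stage_of [48; 5; 91; 9; 37; 19; 73; 27; 181; 61; 31; 11; 25; 41; 32; 17; 241; 97]%N.

Definition primes100 : list N := [2; 3; 5; 7; 11; 13; 17; 19; 23; 29; 31; 37; 41; 43;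
  47; 53; 59; 61; 67; 71; 73; 79; 83; 89; 97]%N.
Definition horizon : nat := 1445.
Definition trees : list (N * tree) := map (fun p => (p, prime_tree chain horizon p)) primes100.
Fixpoint lookup (p : N) (l : list (N * tree)) : tree :=
  if l is (q, t) :: l then if (p =? q)%N then t else lookup p l else Stop.
Definition tree_of (p : N) : tree := lookup p trees.

Fixpoint positives (ps : list N) (r : terms) : terms :=
  if ps is p :: ps then TCons false (tree_of p) (positives ps r) else r.
(** The halving counts the subtracted term too: [length ps + 1] terms are divided as evenly as
    possible, [z] going to the right half. *)
Definition refutes (ps : list N) (z c : N) : bool :=
  let h := Nat.div2 (S (S (length ps))) in
  sieve chain (map (fun s => residue s c) chain) (positives (firstn h ps) TNil)
    (positives (skipn h ps) (TCons true (tree_of z) TNil)).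

(** * Lists of known solutions with large terms *)

(** Pairs (base, exponent): the added powers, then the subtracted one. The right-hand side is
    recomputed from them. *)
Definition witness : Type := (list (N * N) * (N * N))%type.

(** Solutions in which 2 has exponent at least 16. Since 2^16 = 65520 + 16, the orbit of 2 modulo
    65520 stops at 2^15, and [hits] cannot see them. *)
Definition witnesses1 : list witness := [
  ([(2, 17)], (19, 4)); ([(2, 17); (3, 0)], (19, 4)); ([(2, 17); (3, 3)], (19, 4));
  ([(2, 17); (3, 4)], (19, 4)); ([(2, 17); (3, 5)], (19, 4)); ([(2, 17); (5, 1)], (19, 4));
  ([(2, 17); (5, 3)], (19, 4)); ([(2, 17); (7, 0)], (19, 4)); ([(2, 17); (7, 1)], (19, 4));
  ([(2, 17); (7, 2)], (19, 4)); ([(2, 17); (11, 0)], (19, 4)); ([(2, 17); (11, 1)], (19, 4));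
  ([(2, 17); (11, 2)], (19, 4)); ([(2, 16); (11, 4)], (43, 3)); ([(2, 17); (13, 0)], (19, 4));
  ([(2, 17); (13, 1)], (19, 4)); ([(2, 17); (13, 2)], (19, 4)); ([(2, 17); (17, 0)], (19, 4));
  ([(2, 17); (17, 1)], (19, 4)); ([(2, 16); (17, 4)], (53, 3)); ([(2, 17); (23, 0)], (19, 4));
  ([(2, 17); (23, 1)], (19, 4)); ([(2, 17); (29, 0)], (19, 4)); ([(2, 17); (29, 1)], (19, 4));
  ([(2, 17); (31, 0)], (19, 4)); ([(2, 17); (31, 1)], (19, 4)); ([(2, 17); (37, 0)], (19, 4));
  ([(2, 17); (37, 1)], (19, 4)); ([(2, 17); (41, 0)], (19, 4)); ([(2, 17); (41, 1)], (19, 4));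
  ([(2, 17); (43, 0)], (19, 4)); ([(2, 17); (43, 1)], (19, 4)); ([(2, 17); (47, 0)], (19, 4));
  ([(2, 17); (47, 1)], (19, 4)); ([(2, 17); (53, 0)], (19, 4)); ([(2, 17); (53, 1)], (19, 4));
  ([(2, 17); (53, 3)], (23, 4)); ([(2, 17); (59, 0)], (19, 4)); ([(2, 17); (59, 1)], (19, 4));
  ([(2, 16); (59, 2)], (41, 3)); ([(2, 17); (61, 0)], (19, 4)); ([(2, 17); (61, 1)], (19, 4));
  ([(2, 16); (61, 2)], (41, 3)); ([(2, 17); (61, 3)], (71, 3)); ([(2, 17); (67, 0)], (19, 4));
  ([(2, 17); (67, 1)], (19, 4)); ([(2, 17); (71, 0)], (19, 4)); ([(2, 17); (71, 1)], (19, 4));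
  ([(2, 17); (73, 0)], (19, 4)); ([(2, 17); (73, 1)], (19, 4)); ([(2, 19); (73, 3)], (97, 3));
  ([(2, 17); (79, 0)], (19, 4)); ([(2, 17); (79, 1)], (19, 4)); ([(2, 17); (83, 0)], (19, 4));
  ([(2, 17); (83, 1)], (19, 4)); ([(2, 19); (89, 2)], (3, 12)); ([(2, 17); (89, 1)], (19, 4));
  ([(2, 17); (97, 0)], (19, 4)); ([(2, 17); (97, 1)], (19, 4)); ([(3, 10); (83, 2)], (2, 16));
  ([(5, 9); (23, 5)], (2, 23)); ([(5, 6); (37, 3)], (2, 16)); ([(11, 3); (19, 4)], (2, 17));
  ([(19, 4); (29, 2)], (2, 17)); ([(19, 4); (31, 2)], (2, 17)); ([(19, 4); (37, 2)], (2, 17));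
  ([(19, 4); (41, 2)], (2, 17))]%N.

(** Solutions whose subtracted power exceeds 1048, the bound built into [negatives]. Those obtained
    from a shorter entry by adding a small power need not be listed, because [solved_step]
    propagates solutions to larger sets of primes. *)
Definition witnesses2 : list witness := [
  ([(2, 9); (3, 7)], (7, 4)); ([(2, 11); (3, 6)], (7, 4)); ([(2, 10); (3, 7)], (7, 4));
  ([(2, 14); (5, 4)], (7, 5)); ([(2, 11); (5, 4)], (7, 4)); ([(2, 0); (5, 5)], (7, 4));
  ([(2, 1); (5, 5)], (7, 4)); ([(2, 2); (5, 5)], (7, 4)); ([(2, 3); (5, 5)], (7, 4));
  ([(2, 4); (5, 5)], (7, 4)); ([(2, 5); (5, 5)], (7, 4)); ([(2, 6); (5, 5)], (7, 4));
  ([(2, 7); (5, 5)], (7, 4)); ([(2, 11); (5, 6)], (7, 5)); ([(3, 0); (5, 5)], (7, 4));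
  ([(3, 3); (5, 5)], (7, 4)); ([(3, 5); (5, 5)], (7, 4)); ([(2, 10); (3, 6); (5, 6)], (7, 5));
  ([(2, 10); (3, 6)], (11, 3)); ([(2, 11); (3, 0)], (11, 3)); ([(2, 11); (3, 4)], (11, 3));
  ([(2, 0); (3, 7)], (11, 3)); ([(2, 1); (3, 7)], (11, 3)); ([(2, 2); (3, 7)], (11, 3));
  ([(2, 4); (3, 7)], (11, 3)); ([(2, 5); (3, 7)], (11, 3)); ([(2, 6); (3, 7)], (11, 3));
  ([(2, 11); (3, 5)], (11, 3)); ([(2, 10); (5, 4)], (11, 3)); ([(2, 11); (5, 0)], (11, 3));
  ([(2, 11); (5, 1)], (11, 3)); ([(2, 11); (5, 3)], (11, 3)); ([(2, 0); (5, 6)], (11, 4));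
  ([(2, 1); (5, 6)], (11, 4)); ([(2, 2); (5, 6)], (11, 4)); ([(2, 3); (5, 6)], (11, 4));
  ([(2, 4); (5, 6)], (11, 4)); ([(2, 10); (7, 3)], (11, 3)); ([(2, 11); (7, 0)], (11, 3));
  ([(2, 11); (7, 1)], (11, 3)); ([(2, 11); (7, 2)], (11, 3)); ([(3, 7); (5, 1)], (11, 3));
  ([(3, 7); (5, 2)], (11, 3)); ([(3, 7); (5, 3)], (11, 3)); ([(3, 0); (5, 6)], (11, 4));
  ([(3, 1); (5, 6)], (11, 4)); ([(3, 2); (5, 6)], (11, 4)); ([(3, 7); (7, 0)], (11, 3));
  ([(3, 7); (7, 1)], (11, 3)); ([(3, 7); (7, 2)], (11, 3)); ([(5, 6); (7, 0)], (11, 4));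
  ([(5, 6); (7, 1)], (11, 4)); ([(2, 11); (3, 5)], (13, 3)); ([(2, 11); (5, 4)], (13, 3));
  ([(2, 0); (5, 5)], (13, 3)); ([(2, 1); (5, 5)], (13, 3)); ([(2, 2); (5, 5)], (13, 3));
  ([(2, 3); (5, 5)], (13, 3)); ([(2, 4); (5, 5)], (13, 3)); ([(2, 5); (5, 5)], (13, 3));
  ([(2, 6); (5, 5)], (13, 3)); ([(2, 11); (7, 3)], (13, 3)); ([(2, 0); (7, 4)], (13, 3));
  ([(2, 2); (7, 4)], (13, 3)); ([(2, 3); (7, 4)], (13, 3)); ([(2, 4); (7, 4)], (13, 3));
  ([(2, 5); (7, 4)], (13, 3)); ([(2, 6); (7, 4)], (13, 3)); ([(2, 8); (7, 4)], (13, 3));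
  ([(2, 9); (7, 4)], (13, 3)); ([(2, 10); (11, 3)], (13, 3)); ([(3, 0); (5, 5)], (13, 3));
  ([(3, 1); (5, 5)], (13, 3)); ([(3, 2); (5, 5)], (13, 3)); ([(3, 3); (5, 5)], (13, 3));
  ([(3, 0); (7, 4)], (13, 3)); ([(3, 1); (7, 4)], (13, 3)); ([(3, 2); (7, 4)], (13, 3));
  ([(3, 4); (7, 4)], (13, 3)); ([(3, 5); (7, 4)], (13, 3)); ([(3, 6); (7, 4)], (13, 3));
  ([(5, 0); (7, 4)], (13, 3)); ([(5, 1); (7, 4)], (13, 3)); ([(5, 2); (7, 4)], (13, 3));
  ([(5, 3); (7, 4)], (13, 3)); ([(5, 4); (7, 4)], (13, 3)); ([(5, 5); (7, 0)], (13, 3));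
  ([(5, 5); (7, 1)], (13, 3)); ([(5, 5); (7, 2)], (13, 3)); ([(5, 5); (11, 0)], (13, 3));
  ([(5, 5); (11, 1)], (13, 3)); ([(7, 4); (11, 0)], (13, 3)); ([(7, 4); (11, 1)], (13, 3));
  ([(7, 4); (11, 2)], (13, 3)); ([(2, 10); (3, 6); (5, 4)], (13, 3));
  ([(2, 9); (3, 6); (11, 3)], (13, 3)); ([(2, 13); (3, 9); (11, 3)], (13, 4));
  ([(2, 13); (3, 8); (11, 4)], (13, 4)); ([(2, 11); (5, 3); (11, 2)], (13, 3));
  ([(5, 4); (7, 3); (11, 3)], (13, 3)); ([(2, 12); (11, 3)], (17, 3)); ([(3, 7); (5, 5)], (17, 3));
  ([(5, 5); (7, 4)], (17, 3)); ([(5, 5); (13, 3)], (17, 3)); ([(2, 10); (3, 7); (7, 4)], (17, 3));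
  ([(2, 11); (3, 7); (11, 3)], (17, 3)); ([(2, 12); (5, 4); (7, 3)], (17, 3));
  ([(2, 9); (5, 5); (11, 3)], (17, 3)); ([(2, 10); (5, 5); (11, 3)], (17, 3));
  ([(2, 12); (5, 7); (13, 3)], (17, 4)); ([(2, 11); (7, 4); (11, 3)], (17, 3));
  ([(2, 9); (7, 4); (13, 3)], (17, 3)); ([(2, 10); (7, 4); (13, 3)], (17, 3));
  ([(2, 11); (11, 3); (13, 3)], (17, 3)); ([(3, 7); (5, 4); (13, 3)], (17, 3));
  ([(3, 6); (7, 4); (13, 3)], (17, 3)); ([(3, 7); (11, 3); (13, 3)], (17, 3));
  ([(5, 4); (7, 4); (13, 3)], (17, 3)); ([(2, 16); (3, 6); (5, 6); (13, 3)], (17, 4));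
  ([(2, 13); (3, 10); (11, 4); (13, 3)], (17, 4)); ([(3, 7); (5, 7); (7, 4); (11, 3)], (17, 4));
  ([(3, 7); (5, 7); (11, 3); (13, 3)], (17, 4)); ([(5, 7); (7, 4); (11, 3); (13, 3)], (17, 4));
  ([(2, 9); (3, 8)], (19, 3)); ([(2, 17); (3, 0)], (19, 4)); ([(2, 17); (3, 3)], (19, 4));
  ([(2, 17); (3, 4)], (19, 4)); ([(2, 17); (3, 5)], (19, 4)); ([(2, 17); (5, 1)], (19, 4));
  ([(2, 17); (5, 3)], (19, 4)); ([(2, 17); (7, 0)], (19, 4)); ([(2, 17); (7, 1)], (19, 4));
  ([(2, 17); (7, 2)], (19, 4)); ([(2, 17); (11, 0)], (19, 4)); ([(2, 17); (11, 1)], (19, 4));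
  ([(2, 17); (11, 2)], (19, 4)); ([(2, 17); (13, 0)], (19, 4)); ([(2, 17); (13, 1)], (19, 4));
  ([(2, 17); (13, 2)], (19, 4)); ([(2, 11); (17, 3)], (19, 3)); ([(2, 17); (17, 0)], (19, 4));
  ([(2, 17); (17, 1)], (19, 4)); ([(3, 8); (5, 4)], (19, 3)); ([(3, 8); (7, 3)], (19, 3));
  ([(7, 4); (17, 3)], (19, 3)); ([(13, 3); (17, 3)], (19, 3));
  ([(2, 11); (5, 5); (7, 4)], (19, 3)); ([(2, 12); (7, 4); (11, 3)], (19, 3));
  ([(2, 13); (7, 6); (17, 3)], (19, 4)); ([(2, 15); (11, 4); (17, 4)], (19, 4));
  ([(3, 7); (5, 5); (13, 3)], (19, 3)); ([(3, 6); (11, 3); (17, 3)], (19, 3));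
  ([(5, 5); (7, 4); (13, 3)], (19, 3)); ([(2, 19); (3, 12); (11, 3); (17, 5)], (19, 5));
  ([(2, 12); (11, 4); (13, 4); (17, 4)], (19, 4)); ([(3, 7); (5, 4); (7, 4); (13, 3)], (19, 3));
  ([(3, 6); (5, 5); (11, 3); (13, 3)], (19, 3)); ([(3, 9); (5, 7); (13, 4); (17, 3)], (19, 4));
  ([(3, 8); (7, 6); (11, 3); (17, 3)], (19, 4)); ([(3, 8); (7, 6); (13, 3); (17, 3)], (19, 4));
  ([(5, 5); (11, 3); (13, 3); (17, 2)], (19, 3)); ([(2, 13); (17, 3)], (23, 3));
  ([(2, 13); (3, 7); (7, 4)], (23, 3)); ([(2, 12); (3, 8); (7, 4)], (23, 3));
  ([(2, 13); (3, 7); (13, 3)], (23, 3)); ([(2, 12); (3, 8); (13, 3)], (23, 3));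
  ([(2, 12); (3, 7); (19, 3)], (23, 3)); ([(2, 13); (5, 5); (11, 3)], (23, 3));
  ([(2, 18); (7, 5); (11, 3)], (23, 4)); ([(2, 11); (7, 6); (11, 5)], (23, 4));
  ([(2, 13); (7, 4); (13, 3)], (23, 3)); ([(2, 15); (7, 6); (19, 4)], (23, 4));
  ([(2, 12); (13, 3); (19, 3)], (23, 3)); ([(2, 9); (17, 3); (19, 3)], (23, 3));
  ([(3, 8); (11, 3); (17, 3)], (23, 3)); ([(5, 5); (7, 4); (19, 3)], (23, 3));
  ([(5, 4); (17, 3); (19, 3)], (23, 3)); ([(11, 3); (17, 3); (19, 3)], (23, 3));
  ([(2, 12); (3, 8); (5, 4); (11, 3)], (23, 3)); ([(2, 12); (5, 5); (11, 2); (17, 3)], (23, 3));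
  ([(2, 12); (7, 4); (11, 3); (17, 3)], (23, 3)); ([(2, 10); (7, 6); (11, 5); (19, 2)], (23, 4));
  ([(2, 17); (7, 5); (13, 3); (19, 4)], (23, 4)); ([(2, 8); (7, 3); (17, 3); (19, 3)], (23, 3));
  ([(3, 5); (7, 3); (17, 3); (19, 3)], (23, 3)); ([(3, 7); (11, 3); (13, 3); (19, 3)], (23, 3));
  ([(5, 7); (7, 6); (11, 3); (17, 4)], (23, 4)); ([(7, 4); (11, 3); (13, 3); (19, 3)], (23, 3));
  ([(2, 11); (7, 4); (11, 3); (13, 3); (17, 3)], (23, 3)); ([(2, 13); (7, 5)], (29, 3));
  ([(3, 9); (17, 3)], (29, 3)); ([(2, 12); (3, 9); (11, 3)], (29, 3));
  ([(2, 12); (3, 8); (11, 4)], (29, 3)); ([(2, 14); (3, 8); (13, 3)], (29, 3));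
  ([(2, 13); (5, 6); (11, 3)], (29, 3)); ([(2, 13); (7, 4); (11, 4)], (29, 3));
  ([(2, 10); (7, 5); (19, 3)], (29, 3)); ([(2, 13); (11, 4); (13, 3)], (29, 3));
  ([(2, 13); (17, 3); (23, 3)], (29, 3)); ([(3, 8); (5, 6); (7, 4)], (29, 3));
  ([(3, 9); (5, 5); (7, 4)], (29, 3)); ([(3, 9); (5, 5); (13, 3)], (29, 3));
  ([(3, 7); (5, 6); (19, 3)], (29, 3)); ([(3, 8); (7, 5); (11, 3)], (29, 3));
  ([(5, 6); (7, 4); (19, 3)], (29, 3)); ([(5, 6); (13, 3); (19, 3)], (29, 3));
  ([(7, 5); (11, 3); (19, 3)], (29, 3)); ([(2, 9); (3, 8); (5, 5); (11, 4)], (29, 3));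
  ([(2, 13); (3, 5); (5, 6); (23, 2)], (29, 3)); ([(2, 11); (3, 8); (5, 6); (23, 2)], (29, 3));
  ([(2, 12); (3, 7); (7, 5); (13, 3)], (29, 3)); ([(2, 10); (3, 9); (7, 4); (13, 3)], (29, 3));
  ([(2, 10); (3, 7); (11, 4); (19, 3)], (29, 3)); ([(2, 14); (3, 8); (11, 3); (23, 2)], (29, 3));
  ([(2, 34); (3, 14); (13, 7); (19, 5)], (29, 7)); ([(2, 11); (5, 5); (11, 4); (17, 3)], (29, 3));
  ([(2, 13); (5, 6); (11, 2); (23, 2)], (29, 3)); ([(2, 13); (5, 5); (11, 3); (23, 3)], (29, 3));
  ([(2, 15); (5, 8); (17, 3); (23, 4)], (29, 4)); ([(2, 11); (7, 5); (11, 3); (17, 3)], (29, 3));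
  ([(2, 10); (7, 4); (11, 4); (19, 3)], (29, 3)); ([(2, 10); (11, 4); (13, 3); (19, 3)], (29, 3));
  ([(2, 12); (13, 3); (19, 3); (23, 3)], (29, 3)); ([(2, 10); (17, 3); (19, 3); (23, 3)], (29, 3));
  ([(3, 8); (5, 5); (7, 3); (11, 4)], (29, 3)); ([(3, 12); (5, 7); (11, 4); (17, 4)], (29, 4));
  ([(3, 8); (5, 5); (11, 4); (23, 2)], (29, 3)); ([(3, 7); (7, 5); (11, 3); (17, 3)], (29, 3));
  ([(3, 9); (7, 4); (13, 3); (17, 2)], (29, 3)); ([(3, 9); (7, 4); (13, 3); (23, 2)], (29, 3));
  ([(3, 6); (11, 4); (13, 3); (19, 3)], (29, 3)); ([(5, 6); (7, 4); (13, 3); (17, 3)], (29, 3));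
  ([(5, 4); (7, 5); (13, 2); (19, 3)], (29, 3)); ([(5, 5); (7, 4); (19, 3); (23, 3)], (29, 3));
  ([(5, 4); (7, 5); (19, 3); (23, 2)], (29, 3)); ([(5, 5); (11, 4); (13, 3); (17, 3)], (29, 3));
  ([(7, 5); (11, 3); (13, 3); (17, 3)], (29, 3)); ([(7, 5); (17, 2); (19, 3); (23, 2)], (29, 3));
  ([(11, 3); (17, 3); (19, 3); (23, 3)], (29, 3));
  ([(2, 18); (5, 8); (11, 4); (13, 4); (23, 3)], (29, 4));
  ([(2, 13); (5, 5); (13, 3); (17, 3); (19, 3)], (29, 3));
  ([(2, 14); (7, 4); (17, 3); (19, 2); (23, 2)], (29, 3));
  ([(3, 5); (7, 3); (17, 3); (19, 3); (23, 3)], (29, 3));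
  ([(3, 8); (7, 5); (17, 2); (19, 2); (23, 2)], (29, 3));
  ([(3, 7); (11, 3); (13, 3); (19, 3); (23, 3)], (29, 3));
  ([(5, 4); (7, 3); (11, 4); (13, 3); (19, 3)], (29, 3));
  ([(5, 6); (7, 3); (11, 3); (19, 3); (23, 2)], (29, 3));
  ([(5, 5); (7, 4); (13, 3); (17, 3); (23, 3)], (29, 3));
  ([(5, 4); (11, 4); (13, 3); (19, 3); (23, 2)], (29, 3));
  ([(5, 6); (11, 3); (17, 2); (19, 3); (23, 2)], (29, 3));
  ([(5, 5); (13, 3); (17, 2); (19, 3); (23, 3)], (29, 3));
  ([(7, 3); (11, 4); (13, 3); (19, 3); (23, 2)], (29, 3))]%N.

(** The 45 ways to choose the subtracted pair and to split the other four primes into two pairs,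
    each with the exponent vectors of solutions whose subtracted product exceeds 4096, the bound in
    [decided3]. *)
Definition pairings : list (list N * list (list N)) := [
  ([5; 7; 11; 13; 2; 3], [
    [3; 2; 3; 0; 0; 8]; [2; 3; 0; 0; 5; 5]; [2; 3; 0; 2; 5; 5]; [1; 0; 2; 2; 0; 9];
  [0; 1; 2; 2; 0; 9]; [0; 2; 2; 2; 0; 9]; [3; 0; 2; 2; 0; 9]; [2; 1; 2; 2; 0; 9];
  [3; 1; 1; 3; 13; 1]; [1; 0; 0; 4; 10; 3]; [2; 4; 0; 0; 0; 10]; [2; 4; 0; 1; 0; 10];
  [7; 0; 2; 1; 2; 9]; [0; 5; 5; 0; 0; 11]]);
  ([5; 11; 7; 13; 2; 3], [
    [4; 1; 2; 0; 11; 1]; [4; 1; 0; 2; 0; 8]; [4; 1; 3; 0; 0; 8]; [2; 2; 3; 1; 0; 8];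
  [0; 4; 0; 3; 14; 0]; [0; 2; 5; 0; 14; 0]; [2; 2; 5; 0; 0; 9]; [6; 0; 3; 1; 0; 9];
  [2; 1; 4; 1; 7; 5]; [2; 3; 0; 0; 15; 0]; [2; 3; 2; 0; 15; 0]; [2; 3; 3; 0; 15; 0];
  [0; 5; 5; 0; 0; 11]]);
  ([5; 13; 7; 11; 2; 3], [
    [3; 1; 3; 1; 9; 2]; [0; 1; 2; 2; 6; 4]; [5; 0; 3; 1; 11; 1]; [1; 2; 2; 2; 0; 8];
  [5; 0; 3; 1; 0; 8]; [3; 1; 2; 2; 0; 8]; [2; 2; 2; 2; 10; 2]; [1; 2; 1; 3; 10; 2];
  [5; 0; 5; 0; 0; 9]; [1; 3; 1; 3; 0; 9]; [3; 2; 2; 1; 8; 4]; [5; 2; 3; 1; 0; 12]]);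
  ([3; 7; 11; 13; 2; 5], [
    [6; 1; 0; 2; 3; 4]; [1; 4; 1; 0; 1; 5]; [8; 0; 0; 3; 6; 3]; [1; 4; 2; 1; 13; 0];
  [3; 3; 3; 0; 4; 4]; [0; 5; 2; 0; 7; 3]; [2; 0; 2; 2; 5; 4]; [1; 2; 2; 2; 5; 4];
  [5; 3; 3; 1; 5; 5]]);
  ([3; 11; 7; 13; 2; 5], [
    [0; 3; 3; 1; 3; 4]; [0; 3; 3; 1; 10; 1]; [0; 1; 2; 2; 6; 3]; [0; 4; 1; 2; 0; 6];
  [6; 0; 1; 3; 0; 6]; [6; 1; 2; 2; 0; 6]; [2; 3; 3; 1; 0; 6]; [2; 2; 1; 3; 0; 6];
  [0; 0; 5; 0; 7; 3]]);
  ([3; 13; 7; 11; 2; 5], [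
    [1; 0; 2; 2; 10; 1]; [0; 2; 2; 2; 10; 1]; [1; 3; 1; 3; 0; 6]; [0; 1; 5; 0; 14; 0];
  [0; 2; 3; 2; 13; 1]; [4; 2; 2; 3; 0; 7]]);
  ([3; 5; 11; 13; 2; 7], [
    [2; 4; 2; 1; 7; 2]; [1; 5; 0; 3; 5; 3]; [1; 1; 3; 1; 14; 0]; [3; 0; 3; 1; 14; 0];
  [4; 0; 3; 1; 14; 0]; [0; 6; 3; 0; 0; 5]; [0; 6; 2; 1; 0; 5]; [0; 0; 3; 1; 0; 5];
  [2; 0; 3; 1; 0; 5]; [0; 2; 3; 1; 0; 5]; [3; 0; 3; 1; 0; 5]; [1; 2; 3; 1; 0; 5];
  [0; 3; 3; 1; 0; 5]; [0; 6; 1; 2; 0; 5]; [2; 2; 3; 1; 0; 5]; [4; 1; 3; 1; 0; 5];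
  [0; 5; 4; 0; 0; 5]; [2; 4; 3; 1; 6; 3]; [2; 4; 2; 2; 9; 2]; [2; 5; 3; 0; 12; 1];
  [4; 4; 3; 1; 2; 5]]);
  ([3; 11; 5; 13; 2; 7], [
    [0; 3; 2; 2; 1; 4]; [0; 1; 4; 1; 10; 1]; [0; 3; 6; 0; 0; 5]; [9; 0; 0; 1; 3; 4];
  [6; 2; 1; 1; 8; 3]]);
  ([3; 13; 5; 11; 2; 7], [
    [3; 2; 4; 0; 1; 4]; [5; 1; 5; 0; 4; 3]; [8; 0; 4; 0; 7; 2]; [0; 2; 3; 2; 11; 1];
  [0; 3; 3; 2; 14; 0]; [2; 2; 6; 0; 0; 5]; [0; 3; 3; 2; 0; 5]; [5; 1; 0; 4; 0; 5];
  [2; 3; 0; 4; 1; 5]; [8; 1; 2; 3; 0; 6]]);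
  ([3; 5; 7; 13; 2; 11], [
    [0; 5; 4; 0; 2; 3]; [2; 4; 2; 1; 2; 3]; [8; 0; 2; 2; 0; 4]; [0; 0; 1; 3; 0; 4];
  [7; 1; 3; 1; 0; 4]; [0; 2; 1; 3; 0; 4]; [1; 2; 1; 3; 0; 4]; [3; 1; 1; 3; 0; 4];
  [2; 2; 1; 3; 0; 4]; [5; 0; 1; 3; 0; 4]; [0; 6; 0; 0; 0; 4]; [0; 6; 0; 1; 0; 4];
  [0; 2; 5; 0; 14; 0]; [0; 4; 4; 1; 8; 2]; [0; 1; 6; 0; 3; 4]; [4; 1; 6; 0; 3; 4]]);
  ([3; 7; 5; 13; 2; 11], [
    [1; 3; 4; 1; 13; 0]; [5; 2; 2; 0; 10; 1]; [5; 2; 2; 1; 10; 1]; [7; 1; 0; 0; 0; 4];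
  [0; 0; 6; 0; 0; 4]; [1; 0; 6; 0; 0; 4]; [7; 1; 2; 1; 0; 4]; [3; 4; 3; 1; 16; 0];
  [5; 3; 7; 0; 0; 5]]);
  ([3; 13; 5; 7; 2; 11], [
    [2; 2; 4; 1; 2; 3]; [2; 1; 3; 2; 2; 3]; [5; 1; 5; 0; 9; 1]; [8; 0; 2; 3; 0; 4];
  [5; 1; 1; 4; 0; 4]; [6; 1; 3; 2; 0; 4]; [0; 0; 6; 0; 0; 4]; [1; 0; 6; 0; 0; 4];
  [2; 0; 6; 0; 0; 4]; [1; 3; 6; 0; 4; 3]; [1; 3; 1; 5; 13; 1]]);
  ([3; 5; 7; 11; 2; 13], [
    [0; 3; 2; 2; 5; 2]; [5; 0; 1; 3; 2; 3]; [4; 1; 1; 3; 2; 3]; [2; 5; 0; 3; 0; 4];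
  [0; 5; 4; 1; 0; 4]]);
  ([3; 7; 5; 11; 2; 13], [
    [6; 1; 0; 2; 1; 3]; [6; 0; 4; 1; 9; 1]; [1; 4; 3; 1; 13; 0]; [7; 0; 3; 2; 14; 0];
  [4; 3; 3; 1; 0; 4]]);
  ([3; 11; 5; 7; 2; 13], [
    [6; 1; 1; 3; 2; 3]; [2; 3; 0; 5; 0; 4]; [5; 2; 0; 0; 0; 4]; [5; 2; 3; 2; 4; 3]]);
  ([2; 7; 11; 13; 3; 5], [
    [4; 3; 3; 0; 5; 2]; [2; 4; 1; 2; 7; 1]; [5; 2; 4; 0; 0; 6]; [8; 1; 4; 0; 0; 6];
  [0; 0; 3; 1; 3; 4]; [0; 1; 3; 1; 3; 4]; [3; 1; 3; 1; 3; 4]; [4; 1; 3; 1; 3; 4];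
  [0; 3; 3; 1; 3; 4]; [0; 5; 0; 3; 6; 2]; [0; 4; 3; 1; 9; 0]; [0; 0; 2; 2; 9; 0];
  [0; 1; 2; 2; 9; 0]; [0; 2; 2; 2; 9; 0]; [3; 4; 3; 0; 9; 0]; [0; 1; 0; 4; 2; 5];
  [0; 4; 0; 4; 5; 3]; [2; 4; 1; 3; 8; 1]; [0; 5; 5; 0; 11; 0]; [15; 1; 1; 3; 4; 5]]);
  ([2; 11; 7; 13; 3; 5], [
    [0; 3; 2; 2; 1; 5]; [0; 4; 1; 2; 0; 6]; [14; 0; 1; 0; 0; 6]; [14; 0; 0; 1; 0; 6];
  [10; 0; 1; 3; 0; 6]; [14; 0; 0; 2; 0; 6]; [0; 1; 0; 4; 2; 5]; [0; 0; 4; 1; 5; 3];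
  [0; 1; 4; 1; 5; 3]; [3; 1; 4; 1; 5; 3]; [0; 3; 3; 2; 10; 0]; [0; 5; 5; 0; 11; 0];
  [0; 5; 0; 5; 12; 0]]);
  ([2; 13; 7; 11; 3; 5], [
    [0; 0; 2; 2; 2; 4]; [0; 3; 3; 1; 2; 4]; [0; 3; 1; 3; 7; 1]; [3; 3; 1; 1; 3; 4];
  [0; 4; 0; 1; 2; 5]; [0; 4; 0; 2; 2; 5]; [0; 4; 2; 1; 2; 5]; [0; 4; 4; 0; 5; 3];
  [0; 0; 3; 3; 6; 4]; [0; 1; 3; 3; 6; 4]; [0; 5; 0; 5; 12; 0]]);
  ([2; 5; 11; 13; 3; 7], [
    [6; 3; 1; 2; 3; 3]; [9; 2; 1; 0; 5; 2]; [0; 6; 0; 0; 7; 1]; [0; 6; 0; 1; 7; 1];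
  [0; 6; 1; 1; 7; 1]; [0; 6; 0; 2; 7; 1]; [0; 6; 2; 1; 0; 5]; [0; 6; 1; 2; 0; 5];
  [0; 5; 4; 0; 0; 5]; [0; 1; 2; 2; 9; 0]; [6; 0; 2; 2; 9; 0]; [0; 0; 0; 4; 4; 3];
  [0; 2; 0; 4; 4; 3]; [3; 1; 0; 4; 4; 3]; [6; 0; 0; 4; 4; 3]; [0; 3; 0; 4; 4; 3];
  [2; 5; 1; 3; 6; 2]; [16; 0; 0; 1; 3; 4]; [13; 0; 1; 4; 8; 2]]);
  ([2; 11; 5; 13; 3; 7], [
    [0; 3; 2; 2; 6; 1]; [0; 0; 4; 1; 1; 4]; [0; 3; 1; 3; 5; 2]; [0; 4; 0; 3; 0; 5];
  [0; 0; 0; 4; 4; 3]; [0; 2; 0; 4; 4; 3]; [17; 0; 3; 2; 2; 5]]);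
  ([2; 13; 5; 11; 3; 7], [
    [0; 3; 5; 0; 6; 1]; [0; 1; 4; 1; 8; 0]; [0; 2; 4; 1; 8; 0]; [0; 0; 6; 0; 7; 1];
  [0; 1; 6; 0; 7; 1]; [0; 4; 0; 0; 4; 3]; [0; 4; 1; 0; 4; 3]; [0; 4; 0; 1; 4; 3];
  [0; 4; 2; 0; 4; 3]; [0; 4; 1; 1; 4; 3]; [0; 4; 3; 3; 4; 4]]);
  ([2; 5; 7; 13; 3; 11], [
    [0; 0; 1; 3; 0; 4]; [0; 1; 1; 3; 0; 4]; [1; 1; 1; 3; 0; 4]; [0; 2; 1; 3; 0; 4];
  [3; 1; 1; 3; 0; 4]; [0; 3; 1; 3; 0; 4]; [0; 6; 0; 0; 0; 4]; [1; 3; 1; 3; 0; 4];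
  [0; 6; 0; 1; 0; 4]; [0; 6; 3; 1; 9; 0]; [0; 7; 4; 2; 1; 5]]);
  ([2; 7; 5; 13; 3; 11], [
    [0; 0; 4; 1; 6; 1]; [0; 2; 4; 1; 6; 1]; [0; 3; 4; 1; 6; 1]; [0; 0; 6; 0; 0; 4];
  [0; 1; 6; 0; 0; 4]; [0; 5; 4; 1; 7; 1]]);
  ([2; 13; 5; 7; 3; 11], [
    [0; 3; 3; 2; 6; 1]; [0; 1; 2; 3; 6; 1]; [0; 2; 2; 3; 6; 1]; [2; 3; 2; 0; 6; 1];
  [0; 3; 2; 3; 4; 2]; [0; 0; 6; 0; 0; 4]; [0; 1; 6; 0; 0; 4]; [0; 0; 2; 4; 10; 0];
  [0; 1; 2; 4; 10; 0]; [0; 4; 2; 4; 6; 2]; [2; 3; 5; 2; 0; 5]]);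
  ([2; 5; 7; 11; 3; 13], [
    [0; 5; 3; 1; 8; 0]; [0; 5; 3; 1; 1; 3]; [2; 5; 0; 3; 4; 2]; [0; 0; 0; 4; 4; 2];
  [0; 1; 0; 4; 4; 2]; [0; 5; 5; 0; 9; 0]; [0; 5; 5; 0; 2; 3]; [10; 2; 3; 1; 7; 1];
  [0; 5; 4; 1; 0; 4]; [0; 0; 3; 2; 5; 2]; [8; 0; 3; 2; 5; 2]; [0; 7; 3; 3; 5; 3]]);
  ([2; 7; 5; 11; 3; 13], [
    [0; 4; 2; 2; 3; 2]; [0; 4; 5; 0; 3; 2]; [1; 2; 4; 1; 8; 0]; [0; 3; 4; 1; 8; 0];
  [0; 1; 4; 1; 1; 3]; [0; 2; 4; 1; 1; 3]; [0; 3; 1; 3; 1; 3]; [0; 0; 0; 4; 4; 2];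
  [0; 5; 2; 2; 9; 0]; [0; 5; 0; 5; 11; 0]]);
  ([2; 11; 5; 7; 3; 13], [
    [2; 3; 0; 1; 3; 2]; [10; 0; 4; 1; 3; 2]; [0; 3; 3; 2; 8; 0]; [3; 2; 3; 2; 1; 3];
  [0; 3; 3; 2; 1; 3]; [0; 3; 2; 3; 6; 1]; [0; 4; 0; 0; 4; 2]; [0; 4; 0; 1; 4; 2];
  [0; 4; 2; 0; 4; 2]; [13; 0; 1; 4; 2; 3]; [0; 3; 1; 5; 8; 1]; [0; 4; 6; 1; 6; 2];
  [0; 5; 0; 5; 11; 0]]);
  ([2; 3; 11; 13; 5; 7], [
    [10; 1; 0; 3; 4; 1]; [0; 8; 0; 0; 3; 2]; [0; 8; 1; 0; 3; 2]; [0; 8; 0; 1; 3; 2];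
  [0; 8; 2; 0; 3; 2]; [0; 8; 1; 1; 3; 2]; [0; 8; 0; 3; 2; 3]; [7; 4; 0; 3; 1; 4];
  [14; 0; 2; 0; 6; 0]; [14; 0; 0; 2; 6; 0]; [0; 1; 3; 1; 0; 5]; [0; 2; 3; 1; 0; 5];
  [0; 3; 3; 1; 0; 5]; [0; 4; 3; 1; 0; 5]; [0; 7; 2; 2; 5; 1]; [0; 10; 3; 0; 2; 4];
  [0; 10; 2; 1; 2; 4]; [0; 10; 1; 2; 2; 4]]);
  ([2; 11; 3; 13; 5; 7], [
    [0; 1; 3; 2; 4; 1]; [0; 2; 3; 2; 4; 1]; [0; 1; 1; 3; 3; 2]; [3; 1; 1; 3; 3; 2];
  [0; 2; 8; 0; 3; 2]; [0; 2; 1; 3; 3; 2]; [0; 0; 6; 1; 2; 3]; [0; 1; 6; 1; 2; 3];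
  [0; 4; 5; 1; 0; 5]; [11; 1; 0; 1; 5; 1]; [11; 1; 2; 1; 5; 1]; [8; 1; 0; 4; 4; 2]]);
  ([2; 13; 3; 11; 5; 7], [
    [0; 3; 5; 1; 4; 1]; [0; 0; 8; 0; 3; 2]; [0; 1; 8; 0; 3; 2]; [9; 1; 0; 1; 3; 2];
  [0; 3; 8; 0; 2; 3]; [0; 3; 0; 4; 0; 5]; [13; 0; 0; 4; 5; 1]; [0; 4; 5; 1; 4; 2]]);
  ([2; 3; 7; 13; 5; 11], [
    [5; 5; 1; 1; 4; 1]; [0; 0; 1; 3; 0; 4]; [0; 2; 1; 3; 0; 4]; [4; 1; 1; 3; 0; 4];
  [6; 0; 1; 3; 0; 4]; [0; 1; 1; 3; 3; 2]; [0; 2; 1; 3; 3; 2]; [0; 5; 1; 3; 3; 2];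
  [0; 6; 1; 3; 3; 2]; [0; 6; 1; 3; 6; 0]; [10; 0; 1; 3; 6; 0]; [14; 0; 0; 2; 6; 0];
  [12; 0; 4; 1; 5; 1]]);
  ([2; 7; 3; 13; 5; 11], [
    [0; 4; 3; 2; 1; 3]; [0; 3; 1; 3; 4; 1]; [2; 5; 8; 0; 1; 4]]);
  ([2; 13; 3; 7; 5; 11], [
    [0; 0; 1; 4; 1; 3]; [0; 1; 1; 4; 1; 3]; [0; 3; 6; 1; 1; 3]; [1; 2; 1; 4; 1; 3];
  [0; 1; 1; 4; 4; 1]; [0; 2; 1; 4; 4; 1]; [0; 0; 7; 1; 0; 4]; [3; 1; 7; 1; 0; 4];
  [0; 2; 7; 1; 0; 4]; [2; 3; 1; 4; 3; 2]; [12; 0; 5; 2; 3; 2]; [0; 4; 6; 1; 2; 3];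
  [0; 4; 8; 0; 5; 1]]);
  ([2; 3; 7; 11; 5; 13], [
    [0; 6; 3; 1; 2; 2]; [5; 3; 3; 1; 2; 2]; [0; 7; 1; 3; 1; 3]; [0; 9; 4; 0; 3; 2];
  [0; 9; 1; 3; 0; 4]; [0; 0; 3; 2; 5; 1]; [0; 1; 3; 2; 5; 1]; [0; 2; 3; 2; 5; 1];
  [3; 1; 3; 2; 5; 1]; [0; 11; 4; 1; 6; 1]]);
  ([2; 7; 3; 11; 5; 13], [
    [1; 4; 0; 2; 2; 2]; [0; 4; 5; 1; 2; 2]; [0; 4; 8; 0; 4; 1]; [0; 0; 2; 3; 1; 3];
  [6; 3; 0; 1; 3; 2]; [0; 4; 9; 0; 3; 2]; [0; 0; 5; 2; 0; 4]]);
  ([2; 11; 3; 7; 5; 13], [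
    [0; 3; 2; 3; 2; 2]; [0; 0; 6; 1; 2; 2]; [0; 1; 6; 1; 2; 2]; [0; 0; 5; 2; 1; 3];
  [0; 1; 5; 2; 1; 3]; [1; 3; 3; 3; 1; 3]; [0; 0; 2; 4; 3; 2]; [0; 4; 1; 4; 3; 2];
  [5; 1; 2; 4; 3; 2]; [1; 4; 0; 2; 0; 4]; [10; 2; 9; 0; 1; 4]]);
  ([2; 3; 5; 13; 7; 11], [
    [0; 7; 2; 2; 2; 2]; [0; 8; 1; 0; 2; 2]; [0; 8; 1; 1; 2; 2]; [0; 8; 3; 0; 2; 2];
  [0; 8; 0; 2; 2; 2]; [0; 8; 2; 1; 2; 2]; [0; 8; 5; 0; 1; 3]; [0; 7; 4; 1; 1; 3];
  [0; 0; 6; 0; 0; 4]; [0; 1; 6; 0; 0; 4]; [3; 0; 6; 0; 0; 4]; [0; 2; 6; 0; 0; 4];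
  [0; 8; 1; 3; 5; 0]; [9; 1; 5; 1; 3; 2]]);
  ([2; 5; 3; 13; 7; 11], [
    [8; 2; 2; 1; 2; 2]; [0; 1; 1; 3; 2; 2]; [0; 2; 1; 3; 2; 2]; [0; 3; 8; 0; 2; 2];
  [0; 0; 6; 1; 1; 3]; [0; 2; 6; 1; 1; 3]; [0; 4; 6; 1; 1; 3]; [0; 6; 0; 0; 0; 4];
  [0; 6; 2; 0; 0; 4]; [0; 6; 0; 1; 0; 4]; [0; 6; 2; 2; 5; 0]; [9; 3; 2; 2; 2; 3];
  [16; 0; 1; 2; 2; 3]]);
  ([2; 13; 3; 5; 7; 11], [
    [0; 2; 5; 2; 2; 2]; [8; 1; 0; 5; 2; 2]; [0; 0; 8; 0; 2; 2]; [0; 1; 8; 0; 2; 2];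
  [0; 2; 8; 0; 2; 2]; [0; 0; 4; 3; 1; 3]; [0; 2; 4; 3; 1; 3]; [0; 0; 0; 6; 0; 4];
  [1; 0; 0; 6; 0; 4]; [2; 0; 0; 6; 0; 4]; [0; 1; 0; 6; 0; 4]; [7; 1; 0; 6; 5; 0];
  [3; 3; 2; 2; 5; 0]]);
  ([2; 3; 5; 11; 7; 13], [
    [0; 7; 4; 1; 2; 2]; [0; 4; 6; 0; 1; 3]; [0; 6; 3; 2; 1; 3]; [0; 5; 6; 0; 1; 3];
  [0; 6; 6; 0; 1; 3]; [14; 0; 0; 3; 5; 0]; [14; 0; 3; 2; 4; 1]]);
  ([2; 5; 3; 11; 7; 13], [
    [0; 4; 1; 3; 3; 1]; [10; 1; 0; 0; 3; 1]; [10; 1; 0; 2; 3; 1]; [12; 0; 0; 3; 3; 1];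
  [0; 6; 0; 1; 1; 3]; [0; 6; 4; 0; 1; 3]; [0; 6; 2; 1; 1; 3]; [7; 3; 0; 3; 5; 0];
  [0; 5; 0; 4; 5; 0]; [0; 1; 4; 3; 2; 3]; [0; 2; 4; 3; 2; 3]; [0; 4; 4; 3; 2; 3]]);
  ([2; 11; 3; 5; 7; 13], [
    [0; 1; 0; 6; 1; 3]; [5; 0; 0; 6; 1; 3]; [7; 2; 0; 4; 1; 3]; [0; 4; 0; 5; 5; 0];
  [0; 3; 2; 5; 0; 4]; [0; 4; 3; 4; 4; 1]; [0; 3; 5; 3; 4; 1]]);
  ([2; 3; 5; 7; 11; 13], [
    [0; 8; 2; 3; 4; 0]; [0; 0; 6; 0; 4; 0]; [0; 1; 6; 0; 4; 0]; [0; 2; 6; 0; 4; 0];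
  [13; 1; 0; 0; 1; 3]]);
  ([2; 5; 3; 7; 11; 13], [
    [0; 5; 5; 2; 4; 0]; [0; 0; 7; 1; 4; 0]; [0; 3; 7; 1; 4; 0]; [0; 6; 1; 0; 4; 0];
  [0; 6; 2; 0; 4; 0]; [0; 6; 6; 1; 2; 2]; [3; 5; 4; 0; 1; 3]; [3; 5; 1; 2; 1; 3];
  [15; 1; 2; 5; 1; 4]]);
  ([2; 7; 3; 5; 11; 13], [
    [0; 0; 0; 6; 4; 0]; [0; 1; 0; 6; 4; 0]; [0; 5; 2; 3; 3; 1]; [0; 0; 6; 2; 3; 1];
  [4; 0; 6; 2; 3; 1]; [0; 2; 6; 2; 3; 1]])]%N.

(** * Decision procedure for one or two added powers *)

Definition mult : N := 65520.

(** Each residue is stored with the actual power it comes from. The empty list signals that the fuel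
    ran out before a residue recurred; 65520 = 16 * 9 * 5 * 7 * 13 has unit exponent 12, so 20 steps
    suffice. *)
Fixpoint orbit (n : nat) (p r x : N) (acc : list (N * N)) : list (N * N) :=
  match n with
  | O => nil
  | S n => if existsb (fun y => (fst y =? r)%N) acc then acc
           else orbit n p ((r * p) mod mult)%N (x * p)%N ((r, x) :: acc)
  end.
Definition powers (p : N) : list (N * N) := orbit 20 p 1 1 nil.

Fixpoint sums (ps : list N) : list (N * N) :=
  match ps with
  | nil => [(0, 0)]%N
  | p :: ps => let l := sums ps in
    flat_map (fun y => map (fun z => (let r := fst y + fst z in
      if r <? mult then r else r - mult, snd y + snd z)%N) l) (powers p)
  end.

Definition block (r : N) : byte := n2b (N.shiftr r 10).

(** The flag records whether the congruence is an equality between the stored integers, that is,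
    whether a solution has been met. *)
Definition hits_in (off : N) (zr : N * N) (l : list (N * N)) : list (N * bool) :=
  flat_map (fun y => let s := (fst y + off)%N in
    if (fst zr <=? s)%N then let c := (s - fst zr)%N in
      if (c <=? 1000)%N then [(c, (snd y =? snd zr + c)%N)] else nil
    else nil) l.

(** Sums are bucketed by blocks of 1024 residues. A residue at distance at most 1000 above that of
    the subtracted power lies in the same block, in the next one, or, after wrapping around 65520,
    in block 0. *)
Definition hits (ss zs : list (N * N)) : list (N * bool) :=
  let b := fold_left (fun b y => bins (block (fst y)) y b) ss (bempty (N * N)) in
  flat_map (fun zr =>
    hits_in 0 zr (bfind (block (fst zr)) b) ++
    hits_in 0 zr (bfind (block (fst zr + 1024)) b) ++
    (if (mult <=? fst zr + 1000)%N then hits_in mult zr (bfind x00 b) else nil)) zs.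

Fixpoint eql (l l' : list N) : bool :=
  match l, l' with
  | nil, nil => true
  | x :: l, y :: l' => if (x =? y)%N then eql l l' else false
  | _, _ => false
  end.
Definition witness_sum (w : witness) : N :=
  fold_right (fun pe a => fst pe ^ snd pe + a)%N 0%N (fst w).
Definition witness_for (ps : list N) (z : N) (w : witness) : bool :=
  if (fst (snd w) =? z)%N then eql (map fst (fst w)) ps else false.
Definition witness_value (w : witness) : list N :=
  let a := witness_sum w in let b := (fst (snd w) ^ snd (snd w))%N in
  if (b <=? a)%N then [(a - b)%N] else nil.

Definition decided (ws : list witness) (ps : list N) (ss : list (N * N)) (z : N) : bool :=
  let hs := hits ss (powers z) in
  let solved := map fst (filter snd hs) ++ flat_map witness_value (filter (witness_for ps z) ws) in
  forallb (fun h => if existsb (N.eqb (fst h)) solved then true else refutes ps z (fst h)) hs.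

Definition decided_for (p1 : N) : bool :=
  (let ss := sums [p1] in
   forallb (fun z => if (z =? p1)%N then true else decided witnesses1 [p1] ss z) primes100) &&
  forallb (fun p2 => if (p1 <? p2)%N then
    let ss := sums [p1; p2] in
    forallb (fun z => if (z =? p1)%N then true else if (z =? p2)%N then true else
      decided witnesses1 [p1; p2] ss z) primes100
  else true) primes100.

(** * Decision procedure for three to seven added powers, by bitmaps *)

(** In a bitmap of solved cases, bit [i] means right-hand side [1000 - i]: adding p^e to a solution
    raises the right-hand side by p^e, which is a right shift. In a bitmap of refuted cases, bit [c]
    means [c] itself, and the same shift passes from c + p^e down to c. *)
Fixpoint shifts (n : nat) (u p x : N) : N :=
  match n with
  | O => 0%N
  | S n => if (x <=? 2048)%N then N.lor (N.shiftr u x) (shifts n u p (x * p)%N) else 0%N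
  end.

Fixpoint sublists (n : nat) (l : list N) : list (list N) :=
  match n, l with
  | O, _ => [nil]
  | S _, nil => nil
  | S m, p :: l => map (cons p) (sublists m l) ++ sublists n l
  end.
Fixpoint splits (l : list N) : list (N * list N) :=
  match l with
  | nil => nil
  | p :: l => (p, l) :: map (fun y => (fst y, p :: snd y)) (splits l)
  end.
Fixpoint insert (p : N) (l : list N) : list N :=
  match l with
  | nil => [p]
  | q :: l' => if (p <? q)%N then p :: l else q :: insert p l'
  end.
Fixpoint get (l : list N) (tab : list (list N * N)) : N :=
  match tab with
  | nil => 0%N
  | (l', u) :: tab => if eql l l' then u else get l tab
  end.
Definition union (A : Type) (f : A -> N) (l : list A) : N :=
  fold_right (fun y u => N.lor (f y) u) 0%N l.

Definition witness_bit (w : witness) : N :=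
  let a := witness_sum w in let b := (fst (snd w) ^ snd (snd w) + 1000)%N in
  if (a <=? b)%N then N.shiftl 1 (b - a) else 0%N.

(** The empty sum solves the right-hand sides -z^k, whose bits are 1000 + z^k. With z^k <= 1048
    these bits stay within 2048, the bound used in [shifts]. *)
Fixpoint negatives (n : nat) (z x : N) : N :=
  match n with
  | O => 0%N
  | S n => if (x <=? 1048)%N then N.lor (N.shiftl 1 (1000 + x)) (negatives n z (x * z)%N) else 0%N
  end.
Definition solved_step (z : N) (prev : list (list N * N)) (l : list N) : N :=
  N.lor (union (fun pl => shifts 12 (get (snd pl) prev) (fst pl) 1) (splits l))
        (union witness_bit (filter (witness_for l z) witnesses2)).
Fixpoint solved_tables (z : N) (qs : list N) (n : nat) : list (list (list N * N)) :=
  match n with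
  | O => [[(nil, negatives 12 z 1)]]
  | S m => let ts := solved_tables z qs m in
           map (fun l => (l, solved_step z (hd nil ts) l)) (sublists n qs) :: ts
  end.

(** Reversal turns the index [1000 - c] of a solved bit into the position [c] in a list. *)
Fixpoint reversed_bits (n : nat) (d : N) (acc : list bool) : list bool :=
  match n with O => acc | S n => reversed_bits n (N.div2 d) (N.odd d :: acc) end.
Definition bit_list (d : N) : list bool := reversed_bits 1001 d nil.
Fixpoint undecided (l : list bool) (u c : N) : list N :=
  match l with
  | nil => nil
  | b :: l => let r := undecided l (N.div2 u) (N.succ c) in
              if b then r else if N.odd u then r else c :: r
  end.
Fixpoint complement (l : list bool) : N :=
  match l with
  | nil => 0%N
  | b :: l => if b then N.double (complement l) else N.succ_double (complement l)
  end.

(** The right-hand sides refuted for free, from the sets having one prime more than [l]. *)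
Definition inherited (qs : list N) (prev : list (list N * N)) (l : list N) : N :=
  union (fun p => if existsb (N.eqb p) l then 0%N else shifts 12 (get (insert p l) prev) p 1) qs.
(** After a table has been checked, every [c] in range that is not marked solved is known to be
    refuted, so the complements serve as the refuted bitmaps of the next, shorter level. *)
Fixpoint descend (z : N) (qs : list N) (n : nat) (ts : list (list (list N * N)))
    (prev : list (list N * N)) : bool :=
  match n, ts with
  | S n, t :: ts =>
    let cur := map (fun ld => (fst ld, bit_list (snd ld))) t in
    if forallb (fun lb => forallb (refutes (fst lb) z)
                 (undecided (snd lb) (inherited qs prev (fst lb)) 0)) cur
    then descend z qs n ts (map (fun lb => (fst lb, complement (snd lb))) cur) else false
  | _, _ => true
  end.
Definition primes30 : list N := [2; 3; 5; 7; 11; 13; 17; 19; 23; 29]%N.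
Definition decided2 (z : N) : bool :=
  let qs := filter (fun p => (p <? z)%N) primes30 in
  let n := Nat.min 7 (length qs) in
  descend z qs (n - 2) (solved_tables z qs n) nil.

(** * Decision procedure for sums of products of two powers *)

(** Multiplies out the top levels of a product trie once, so that this work is shared by all runs of
    the sieve; deeper levels stay pending. *)
Fixpoint force (st : list stage) (t : tree) : tree :=
  match st with
  | nil => t
  | s :: st => pack ((fix loop t := match t with Br k u n => Br k (force st u) (loop n) | _ => Stop end)
                 (unpack (expand s t)))
  end.
Definition primes13 : list N := [2; 3; 5; 7; 11; 13]%N.
Definition product_tree (p q : N) : tree :=
  force (firstn 5 chain) (Pr (tree_of p) (tree_of q) Stop).
Definition pairs13 : list (N * N) :=
  flat_map (fun p => map (pair p) (filter (fun q => (p <? q)%N) primes13)) primes13.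
Definition product_trees : list (N * tree) :=
  map (fun y => ((fst y * snd y)%N, product_tree (fst y) (snd y))) pairs13.

Fixpoint multiples (n : nat) (x p bound : N) : list N :=
  match n with
  | O => nil
  | S n => if (x <=? bound)%N then x :: multiples n (x * p)%N p bound else nil
  end.
Definition products_below (p q bound : N) : list N :=
  flat_map (fun x => multiples 20 x q bound) (multiples 20 1 p bound).
Definition witness3_bit (ps es : list N) : N :=
  match ps, es with
  | [p1; p2; p3; p4; p5; p6], [e1; e2; e3; e4; e5; e6] =>
    let a := (p1 ^ e1 * p2 ^ e2 + p3 ^ e3 * p4 ^ e4)%N in
    let b := (p5 ^ e5 * p6 ^ e6 + 1000)%N in
    if (a <=? b)%N then N.shiftl 1 (b - a) else 0%N
  | _, _ => 0%N
  end.
(** Small solutions are found by shifting: bit [i] is set when x + y + i = w + 1000. The subtracted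
    product w is taken up to 4096; then x and y are at most w + c, hence at most 5096. *)
Definition decided3 (pw : list N * list (list N)) : bool :=
  match fst pw with
  | [p1; p2; p3; p4; p5; p6] =>
    let d0 := union (fun w => N.shiftl 1 (w + 1000)) (products_below p5 p6 4096) in
    let d1 := union (fun y => N.shiftr d0 y) (products_below p3 p4 5096) in
    let d2 := union (fun y => N.shiftr d1 y) (products_below p1 p2 5096) in
    let d := N.lor d2 (union (witness3_bit (fst pw)) (snd pw)) in
    let l := TCons false (lookup (p1 * p2)%N product_trees)
             (TCons false (lookup (p3 * p4)%N product_trees) TNil) in
    let r := TCons true (lookup (p5 * p6)%N product_trees) TNil in
    forallb (fun c => sieve chain (map (fun s => residue s c) chain) l r)
      (undecided (bit_list d) 0 0)
  | _ => false
  end.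

(** * The main computations *)

Lemma all_decided_for : forallb decided_for primes100 = true.
Proof. vm_cast_no_check (eq_refl true). Qed.

Lemma all_decided2 : forallb decided2 (skipn 3 primes30) = true.
Proof. vm_cast_no_check (eq_refl true). Qed.

Lemma all_decided3 : forallb decided3 pairings = true.
Proof. vm_cast_no_check (eq_refl true). Qed.

Lemma refutes_55191 : refutes [2; 3; 5; 7; 11; 13; 17; 19]%N 23 55191 = true.
Proof. vm_cast_no_check (eq_refl true). Qed.

(** * Soundness of the byte arithmetic *)

Definition bz (b : byte) : Z := Z.of_N (b2n b).
Definition mz (s : stage) : Z := Z.of_N (modulus s).
Definition rep (s : stage) (k : byte) (x : Z) : Prop := bz k = (x mod mz s)%Z.

Definition all_bytes : list byte := map n2b (map N.of_nat (seq 0 256)).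
Lemma in_all_bytes b : In b all_bytes.
Proof.
have: existsb (Byte.eqb b) all_bytes = true by case: b; vm_compute.
by move/existsb_exists => [c [hc /Byte.byte_dec_bl ->]].
Qed.

Lemma b2n_inj a b : b2n a = b2n b -> a = b.
Proof.
move=> h; have := Byte.of_to_N a; rewrite -/(b2n a) h /b2n Byte.of_to_N; by case.
Qed.

(** An exhaustive check of the operation tables, so that the correctness of a stage follows from
    computation and the definition of [table] is never unfolded. *)
Definition stage_ok (s : stage) : bool :=
  let q := modulus s in
  (1 <? q)%N &&
  forallb (fun a => forallb (fun b =>
    if isz (bsub s a b) then Byte.eqb a b else
    if (b2n a <? q)%N then if (b2n b <? q)%N then true else true else true) all_bytes &&
    if (b2n a <? q)%N then forallb (fun b =>
      if (b2n b <? q)%N then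
        (b2n (badd s a b) =? (b2n a + b2n b) mod q)%N &&
        (b2n (bsub s a b) =? (b2n a + q - b2n b) mod q)%N &&
        (b2n (bmul s a b) =? (b2n a * b2n b) mod q)%N
      else true) all_bytes else true) all_bytes.

Section Stage.
Variables (s : stage) (ok : stage_ok s = true).

Lemma mz_gt1 : (1 < mz s)%Z.
Proof. move: ok => /andb_prop [/N.ltb_lt h _]; rewrite /mz; lia. Qed.

Lemma rep_lt k x : rep s k x -> (b2n k < modulus s)%N.
Proof.
move=> h; have := Z.mod_pos_bound x (mz s); have := mz_gt1; rewrite -h /bz /mz; lia.
Qed.

Lemma stage_ops a b : (b2n a < modulus s)%N -> (b2n b < modulus s)%N ->
  b2n (badd s a b) = ((b2n a + b2n b) mod modulus s)%N /\
  b2n (bsub s a b) = ((b2n a + modulus s - b2n b) mod modulus s)%N /\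
  b2n (bmul s a b) = ((b2n a * b2n b) mod modulus s)%N.
Proof.
move: ok => /andb_prop [_ /forallb_forall /(_ a (in_all_bytes a))] /andb_prop [_ h].
move=> /N.ltb_lt ha /N.ltb_lt hb; move: h; rewrite ha => /forallb_forall /(_ b (in_all_bytes b)).
by rewrite hb => /andb_prop [/andb_prop [/N.eqb_eq -> /N.eqb_eq ->] /N.eqb_eq ->].
Qed.

Lemma isz_bsub a b : isz (bsub s a b) = true -> a = b.
Proof.
move: ok => /andb_prop [_ /forallb_forall /(_ a (in_all_bytes a))] /andb_prop [+ _].
by move=> /forallb_forall /(_ b (in_all_bytes b)) h hz; move: h; rewrite hz => /Byte.byte_dec_bl.
Qed.

Lemma rep_add k k' x y : rep s k x -> rep s k' y -> rep s (badd s k k') (x + y).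
Proof.
move=> h h'; have [e _] := stage_ops (rep_lt h) (rep_lt h').
have m1 := mz_gt1.
rewrite /rep /bz e N2Z.inj_mod N2Z.inj_add -/(mz s) (h : Z.of_N (b2n k) = _) (h' : Z.of_N (b2n k') = _).
by rewrite -Zplus_mod.
Qed.

Lemma rep_sub k k' x y : rep s k x -> rep s k' y -> rep s (bsub s k k') (x - y).
Proof.
move=> h h'; have [_ [e _]] := stage_ops (rep_lt h) (rep_lt h').
have m1 := mz_gt1; have l' := rep_lt h'.
rewrite /rep /bz e N2Z.inj_mod N2Z.inj_sub; last lia.
rewrite N2Z.inj_add -/(mz s) (h : Z.of_N (b2n k) = _) (h' : Z.of_N (b2n k') = _).
have -> : (x mod mz s + mz s - y mod mz s = x mod mz s - y mod mz s + 1 * mz s)%Z by lia.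
by rewrite Z_mod_plus_full -Zminus_mod.
Qed.

Lemma rep_mul k k' x y : rep s k x -> rep s k' y -> rep s (bmul s k k') (x * y).
Proof.
move=> h h'; have [_ [_ e]] := stage_ops (rep_lt h) (rep_lt h').
rewrite /rep /bz e N2Z.inj_mod N2Z.inj_mul -/(mz s) (h : Z.of_N (b2n k) = _) (h' : Z.of_N (b2n k') = _).
by rewrite -Zmult_mod.
Qed.

Lemma rep_uniq k k' x : rep s k x -> rep s k' x -> k = k'.
Proof. by move=> h h'; apply: b2n_inj; apply: N2Z.inj; exact: (etrans h (esym h')). Qed.

Lemma rep_mod k x y : (x mod mz s = y mod mz s)%Z -> rep s k x -> rep s k y.
Proof. by rewrite /rep => ->. Qed.

Lemma rep0 : rep s x00 0.
Proof. by rewrite /rep Zmod_0_l. Qed.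

Lemma rep1 : rep s x01 1.
Proof. by have h := mz_gt1; rewrite /rep Z.mod_small //; lia. Qed.

Lemma rep_residue n : rep s (residue s n) (Z.of_N n).
Proof.
case: n => [|n]; first exact: rep0.
rewrite /residue; elim: n => [n h|n h|] /=; last exact: rep1.
- have -> : Z.pos n~1 = (Z.pos n + Z.pos n + 1)%Z by lia.
  by apply: rep_add; [exact: rep_add | exact: rep1].
- have -> : Z.pos n~0 = (Z.pos n + Z.pos n)%Z by lia.
  exact: rep_add.
Qed.
End Stage.

(** * The numbers covered by a trie, and expansion of products *)

Fixpoint chain_subs (t : tree) : list (byte * tree) :=
  match t with Br k u n => (k, u) :: chain_subs n | _ => nil end.
Definition subs (t : tree) : list (byte * tree) :=
  match t with
  | B1 k1 u1 => [(k1, u1)]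
  | B2 k1 u1 k2 u2 => [(k1, u1); (k2, u2)]
  | B3 k1 u1 k2 u2 k3 u3 => [(k1, u1); (k2, u2); (k3, u3)]
  | B5 k1 u1 k2 u2 k3 u3 k4 u4 k5 u5 =>
    [(k1, u1); (k2, u2); (k3, u3); (k4, u4); (k5, u5)]
  | t => chain_subs t
  end.
Fixpoint factors (t : tree) : list (tree * tree) :=
  match t with Pr u v n => (u, v) :: factors n | _ => nil end.

Lemma subs_pack t : subs (pack t) = subs t.
Proof.
case: t => //= k1 u1 [] //= k2 u2 [] //= k3 u3 [] //= k4 u4 [] //= k5 u5 [] //=.
Qed.

Lemma chain_subs_unpack t : chain_subs (unpack t) = subs t.
Proof. by case: t. Qed.

(** For properties of the form [some entry is present]: no step of the fold destroys them, and a
    single well-chosen child is enough to create them. *)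
Lemma fold_subs_ind (A : Type) (P : A -> Prop) (g : byte -> tree -> A -> A) t b :
  (forall k u a, P a -> P (g k u a)) ->
  (P b \/ exists k u, In (k, u) (subs t) /\ forall a, P (g k u a)) ->
  P (fold_subs g t b).
Proof.
move=> hg; have chain : forall t b, (P b \/ exists k u, In (k, u) (chain_subs t) /\ forall a, P (g k u a)) ->
  P ((fix loop (t : tree) (b : A) {struct t} : A :=
            match t with Br k u n => loop n (g k u b) | _ => b end) t b).
  elim=> [|???|??????|?????????|???????????????|k u _ n IH|u _ v _ n _] a /=; try by case=> // [[? [? []]]].
  case=> [h|[k' [u' [[[<- <-]|h] h']]]]; apply: IH.
  - by left; apply: hg.
  - by left.
  - by right; exists k', u'.
case: t => [|k1 u1|k1 u1 k2 u2|k1 u1 k2 u2 k3 u3|k1 u1 k2 u2 k3 u3 k4 u4 k5 u5|k0 u0 n|u0 v0 n] h;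
  try exact (chain (Br _ _ _) _ h); try exact (chain Stop _ h); try exact (chain (Pr _ _ _) _ h); case: h => [h|[k [u [h h']]]] /=; try solve [repeat (exact h || apply hg)].
all: move: h => /= h; repeat match goal with H : _ \/ _ |- _ => destruct H as [H|H] end;
  try contradiction; match goal with H : (_, _) = (_, _) |- _ => case: H => ? ?; subst end;
  solve [repeat (exact (h' _) || apply hg)].
Qed.

Lemma all_subsP (g : byte -> tree -> bool) t k u :
  all_subs g t = true -> In (k, u) (subs t) -> g k u = true.
Proof.
have chain : forall t, (fix loop (t : tree) {struct t} : bool :=
    match t with Br k u n => if g k u then loop n else false | _ => true end) t = true ->
    In (k, u) (chain_subs t) -> g k u = true.
  elim=> //= k' u' _ n IH; case e: (g k' u') => // h [[<- <-] //|]; exact: IH.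
case: t => [|k1 u1|k1 u1 k2 u2|k1 u1 k2 u2 k3 u3|k1 u1 k2 u2 k3 u3 k4 u4 k5 u5|k0 u0 n|u0 v0 n];
  move=> h1 h2; try exact (chain (Br _ _ _) h1 h2); try exact (chain Stop h1 h2); try exact (chain (Pr _ _ _) h1 h2);
  move: h1 h2; rewrite /all_subs /subs.
all: move=> h1 /= h2; repeat match goal with H : _ \/ _ |- _ => destruct H as [H|H] end;
  try contradiction; match goal with H : (_, _) = (_, _) |- _ => case: H => ? ?; subst end;
  repeat match type of h1 with (if ?b then _ else _) = _ => destruct b eqn:?; try discriminate h1 end;
  first [reflexivity | assumption].
Qed.

(** The residues of [x] along the stages label a path of the trie. [qcov] says the same of a product
    whose factors are still pending, and [cov] lets a path switch to pending products at any
    level. *)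
Fixpoint pcov (st : list stage) (t : tree) (x : Z) : Prop :=
  match st with
  | nil => True
  | s :: st => exists k u, In (k, u) (subs t) /\ rep s k x /\ pcov st u x
  end.
Definition qcov (st : list stage) (t : tree) (x : Z) : Prop :=
  exists u v y z, In (u, v) (factors t) /\ x = (y * z)%Z /\ pcov st u y /\ pcov st v z.
Fixpoint cov (st : list stage) (t : tree) (x : Z) : Prop :=
  match st with
  | nil => True
  | s :: st' => (exists k u, In (k, u) (subs t) /\ rep s k x /\ cov st' u x) \/ qcov st t x
  end.

Lemma cov_pcov st t x : pcov st t x -> cov st t x.
Proof.
elim: st t => //= s st IH t [k [u [hu [hk h]]]]; left; exists k, u; auto.
Qed.

Lemma cov_qcov st t x : qcov st t x -> cov st t x.
Proof. by case: st => //= s st; right. Qed.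

Section Expand.
Variables (s : stage) (ok : stage_ok s = true) (st : list stage).

Definition has_key (acc : tree) (k : byte) (x : Z) : Prop :=
  exists w, In (k, w) (chain_subs acc) /\ qcov st w x.

Lemma group_old k u v acc k' x : has_key acc k' x -> has_key (group s k u v acc) k' x.
Proof.
elim: acc => [|???|??????|?????????|???????????????|k1 w1 _ n IH|u1 _ v1 _ n _] [w [hw h]] //=; try by case: hw.
case e: (isz _); case: hw => [[e1 e2]|hw]; rewrite /has_key /=.
- subst; exists (Pr u v w); split; first by left.
  by move: h => [a [b [y [z [hab h]]]]]; exists a, b, y, z; split=> //; right.
- by exists w; split=> //; right.
- by subst; exists w; split=> //; left.
- have [|w' [hw' h']] := IH; first by exists w.
  by exists w'; split=> //; right.
Qed.

Lemma group_new k u v acc y z : pcov st u y -> pcov st v z -> has_key (group s k u v acc) k (y * z).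
Proof.
move=> hu hv.
have base n w : has_key (Br k (Pr u v w) n) k (y * z).
  by exists (Pr u v w); split; [left | exists u, v, y, z; split=> //; left].
elim: acc => [|???|??????|?????????|???????????????|k1 w1 _ n IH|u1 _ v1 _ n _] //=.
case e: (isz _); first by rewrite (isz_bsub ok e) in base |- *; exact: base.
have [w [hw h]] := IH; exists w; split=> //; by right.
Qed.

Lemma products_with_old k u v acc k' x :
  has_key acc k' x -> has_key (products_with s k u v acc) k' x.
Proof.
elim: v acc => //= k1 v1 _ n IH acc h; apply: IH; exact: group_old.
Qed.

Lemma products_with_new k u v acc k' v' y z : In (k', v') (chain_subs v) ->
  pcov st u y -> pcov st v' z -> has_key (products_with s k u v acc) (bmul s k k') (y * z).
Proof.
elim: v acc => //= k1 v1 _ n IH acc [[<- <-]|h] hu hv; last exact: IH.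
apply: products_with_old; exact: group_new.
Qed.

Lemma products_old u v acc k' x : has_key acc k' x -> has_key (products s u v acc) k' x.
Proof.
elim: u acc => //= k1 u1 _ n IH acc h; apply: IH; exact: products_with_old.
Qed.

Lemma products_new u v acc k u' k' v' y z : In (k, u') (chain_subs u) -> In (k', v') (chain_subs v) ->
  pcov st u' y -> pcov st v' z -> has_key (products s u v acc) (bmul s k k') (y * z).
Proof.
elim: u acc => //= k1 u1 _ n IH acc [[<- <-]|h] hv' hu hv; last exact: IH.
apply: products_old; exact: (products_with_new _ _ hv').
Qed.

(** The product of the two first labels represents y * z, and the subtries below them become a
    pending pair under that label; later insertions only add pairs. *)
Lemma expand_products_cov t u v y z : In (u, v) (factors t) ->
  pcov (s :: st) u y -> pcov (s :: st) v z ->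
  exists k, rep s k (y * z) /\ has_key (expand_products s t) k (y * z).
Proof.
move=> h [k [u' [hu' [hk hu]]]] [k' [v' [hv' [hk' hv]]]].
exists (bmul s k k'); split; first exact: rep_mul.
elim: t h => //= u1 _ v1 _ n IH [[-> ->]|h]; last by apply: products_old; exact: IH.
by apply: (products_new _ _ _ hu hv); rewrite chain_subs_unpack.
Qed.

Definition opened (t : tree) : tree := match t with Pr _ _ _ => expand s t | _ => t end.

(** Removes the alternative between plain and pending nodes: after opening, a covered number always
    descends to a child labelled by its residue. *)
Lemma opened_cov t x : cov (s :: st) t x ->
  exists k u, In (k, u) (subs (opened t)) /\ rep s k x /\ cov st u x.
Proof.
case=> [[k [u [hu h]]]|[u [v [y [z [h [-> [hu hv]]]]]]]].
  by exists k, u; split=> //; case: t hu.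
have [k [hk [w [hw /cov_qcov hc]]]] := expand_products_cov h hu hv.
exists k, w; split=> //; case: t h hw => //= u1 v1 n _ hw.
rewrite subs_pack; set e := products _ _ _ _ in hw *.
have: chain_subs e = subs e \/ chain_subs e = nil by case: e {hw} => //; auto.
by case=> e'; [rewrite -e' | rewrite e' in hw].
Qed.
End Expand.

(** * Buckets and soundness of the sieve *)

Definition digit_eqb (i j : digit) : bool :=
  match i, j with d0, d0 | d1, d1 | d2, d2 | d3, d3 => true | _, _ => false end.

Lemma sel_upd (A : Type) (f : A -> A) i j (t : quad A) :
  sel i (upd f j t) = if digit_eqb i j then f (sel i t) else sel i t.
Proof. by destruct t, i, j. Qed.

Lemma digit_eqbb i : digit_eqb i i = true.
Proof. by case: i. Qed.

Lemma binsE (A : Type) k (x : A) b : bins k x b =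
  let '(i0, i1, i2, i3) := digits k in upd (upd (upd (upd (cons x) i0) i1) i2) i3 b.
Proof. by case: k. Qed.

Lemma bfindE (A : Type) k (b : bucket A) : bfind k b =
  let '(i0, i1, i2, i3) := digits k in sel i0 (sel i1 (sel i2 (sel i3 b))).
Proof. by case: k. Qed.

Lemma bins_new (A : Type) k (x : A) b : In x (bfind k (bins k x b)).
Proof.
rewrite binsE bfindE; destruct (digits k) as [[[i0 i1] i2] i3].
by do 4! rewrite sel_upd digit_eqbb; left.
Qed.

Lemma bins_old (A : Type) k k' (x y : A) b : In y (bfind k' b) -> In y (bfind k' (bins k x b)).
Proof.
rewrite binsE !bfindE; destruct (digits k) as [[[i0 i1] i2] i3], (digits k') as [[[j0 j1] j2] j3].
rewrite sel_upd; case: (digit_eqb _ _) => //; rewrite sel_upd; case: (digit_eqb _ _) => //.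
rewrite sel_upd; case: (digit_eqb _ _) => //; rewrite sel_upd; case: (digit_eqb _ _) => //.
by right.
Qed.

Definition signed (ng : bool) (x : Z) : Z := if ng then (- x)%Z else x.
Fixpoint tcov (st : list stage) (ts : terms) (y : Z) : Prop :=
  match ts with
  | TNil => y = 0%Z
  | TCons ng t r => exists x z, y = (signed ng x + z)%Z /\ cov st t x /\ tcov st r z
  end.

Section Sieve.
Variables (s : stage) (ok : stage_ok s = true) (st : list stage).

Lemma rep_signed (ng : bool) k k' x y : rep s k y -> rep s k' x ->
  rep s ((if ng then bsub s else badd s) k k') (y + signed ng x).
Proof.
move=> h h'; case: ng => /=; last exact: rep_add.
have -> : (y + - x = y - x)%Z by lia.
exact: rep_sub.
Qed.

Lemma rep_signed' (ng : bool) k k' x y : rep s k y -> rep s k' x ->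
  rep s ((if ng then badd s else bsub s) k k') (y - signed ng x).
Proof.
move=> h h'; case: ng => /=; last exact: rep_sub.
have -> : (y - - x = y + x)%Z by lia.
exact: rep_add.
Qed.

Lemma tcov_cons ng u path x z : cov st u x -> tcov st path z ->
  tcov st (TCons ng u path) (z + signed ng x).
Proof. by move=> h h'; exists x, z; split; [lia | by split]. Qed.

Lemma fill_old ts k path b k' p : In p (bfind k' b) ->
  In p (bfind k' (fill_bucket s (badd s) (bsub s) ts k path b)).
Proof.
elim: ts k path b => [|ng t r IH] k path b h /=; first exact: bins_old.
case: r IH => [|ng' t' r'] IH; apply: (fold_subs_ind (P := fun b => In p (bfind k' b))); try by left.
- by move=> k1 u a; exact: bins_old.
- by move=> k1 u a; exact: IH.
Qed.

(** Here [z] is the part of the half sum already chosen and [y] the part still to be read; following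
    the branch of each summand leads to a stored entry for the whole sum. *)
Lemma fill_new ts k path b y z : tcov (s :: st) ts y -> tcov st path z -> rep s k z ->
  exists k' p, In p (bfind k' (fill_bucket s (badd s) (bsub s) ts k path b)) /\
    rep s k' (z + y) /\ tcov st p (z + y).
Proof.
elim: ts k path b y z => [|ng t r IH] k path b y z /=.
  move=> -> hp hk; exists k, path; rewrite Z.add_0_r; split; first exact: bins_new.
  by split.
move=> [x [y' [-> [/(opened_cov ok) [k1 [u [hu [hk1 hc]]]] hr]]]] hp hk.
have hk' := rep_signed ng hk hk1; have hp' := tcov_cons ng hc hp.
rewrite Z.add_assoc; case: r IH hr => [|ng' t' r'] IH hr.
all: apply: (fold_subs_ind (P := fun b => exists k' p, In p (bfind k' b) /\
       rep s k' (z + signed ng x + y') /\ tcov st p (z + signed ng x + y'))).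
- move=> k2 u2 a [k' [p [h1 h2]]]; exists k', p; split=> //; exact: bins_old.
- right; exists k1, u; split=> // a.
  move: hr => /= ->; rewrite Z.add_0_r; exists ((if ng then bsub s else badd s) k k1), (TCons ng u path).
  by split; [exact: bins_new | split].
- move=> k2 u2 a [k' [p [h1 h2]]]; exists k', p; split=> //; exact: fill_old.
- by right; exists k1, u; split=> // a; apply: IH.
Qed.

Variables (f : terms -> terms -> bool) (b : bucket terms).

Lemma all_pathsP path l p : all_paths f path l = true -> In p l -> f p path = true.
Proof.
elim: l => //= q l IH; case e: (f q path) => // h [<- //|]; exact: IH.
Qed.

(** The invariant is that the key represents [c] minus the part of the right half already chosen. At
    the end it is the residue of the left half, so the stored path [p] is among those compared. *)
Lemma scan_sound ts k path c y z k' p w :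
  scan s (badd s) (bsub s) f b ts k path = true ->
  tcov (s :: st) ts y -> tcov st path z -> rep s k (c - z) ->
  In p (bfind k' b) -> rep s k' w -> (w mod mz s = (c - z - y) mod mz s)%Z ->
  exists path', f p path' = true /\ tcov st path' (z + y).
Proof.
move=> hs hy hz hk hp hw e.
elim: ts k path y z hs hy hz hk e => [|ng t r IH] k path y z /=.
  move=> hs -> hz hk e; rewrite Z.add_0_r; exists path; split=> //.
  have hk3 : rep s k' (c - z) by rewrite /rep hw e; f_equal; lia.
  have ek := rep_uniq hk hk3.
  by subst; apply: all_pathsP hs hp.
move=> hs [x [y' [-> [/(opened_cov ok) [k1 [u [hu [hk1 hc]]]] hr]]]] hz hk e.
have hk2 := rep_signed' ng hk hk1; have hz' := tcov_cons ng hc hz.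
have e1 : (c - z - (signed ng x + y') = c - (z + signed ng x) - y')%Z by lia.
have e2 : (c - z - signed ng x = c - (z + signed ng x))%Z by lia.
rewrite e1 in e; rewrite e2 in hk2; rewrite Z.add_assoc.
case: r IH hr hs => [|ng' t' r'] IH hr hs; have h := all_subsP hs hu.
- move: hr => /= hr; rewrite hr in e *; rewrite Z.add_0_r; exists (TCons ng u path); split=> //.
  set k3 := (if ng then badd s else bsub s) k k1 in h hk2.
  have hk4 : rep s k' (c - (z + signed ng x)) by rewrite /rep hw e; f_equal; lia.
  have ek : k3 = k' := rep_uniq hk2 hk4.
  rewrite ek in h; case eb: (bfind k' b) h hp => [|q l] // h hp.
  exact: (@all_pathsP _ (q :: l) _ h hp).
- exact: (IH _ _ _ _ h hr hz' hk2 e).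
Qed.
End Sieve.

(** Two half sums satisfying all the congruences survive each stage: [fill_new] stores the left one,
    [scan_sound] meets it from the right, and the pair of remaining paths satisfies the same
    hypotheses for the next stage. At the end of the chain the sieve answers [false], a
    contradiction. *)
Lemma sieve_sound st cs l r c y z : forallb stage_ok st = true ->
  Forall2 (fun s k => rep s k c) st cs -> sieve st cs l r = true ->
  tcov st l y -> tcov st r z ->
  (forall s, In s st -> (y mod mz s = (c - z) mod mz s)%Z) -> False.
Proof.
move=> ok hcs; elim: hcs ok l r y z => [//|s k st' cs' hk hcs IH] /= /andb_prop [ok oks] l r y z.
case: s ok hk => q ad sb mu; set s := Stage q ad sb mu => ok hk hs hl hr he.
have [k' [p [hp [hk' hpy]]]] := fill_new ok (bempty terms) hl (erefl : tcov st' TNil 0) (rep0 s).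
have e0 : (k = k) by []; have hk0 : rep s k (c - 0) by rewrite Z.sub_0_r.
have [] := scan_sound ok hs hr (erefl : tcov st' TNil 0) hk0 hp hk'.
  by rewrite Z.add_0_l Z.sub_0_r; apply: he; left.
move=> path [h hpath]; apply: (IH oks _ _ _ _ h hpy hpath) => s' hs'.
by rewrite !Z.add_0_l; apply: he; right.
Qed.

(** * The trie of a prime covers all its powers *)

Section Trees.
Variables (p : N).
Definition pw (e : nat) : Z := (Z.of_N p ^ Z.of_nat e)%Z.

Lemma pwS e : pw (S e) = (pw e * Z.of_N p)%Z.
Proof. rewrite /pw Nat2Z.inj_succ Z.pow_succ_r; lia. Qed.

Lemma iterates_rep s k x n e : stage_ok s = true -> rep s k x -> (e < n)%nat ->
  exists k', nth_error (iterates (bmul s (residue s p)) k n) e = Some k' /\ rep s k' (x * pw e).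
Proof.
move=> ok; elim: n k x e => [|n IH] k x [|e] hk; try lia.
  by exists k; split=> //; rewrite /pw /= Z.mul_1_r.
move=> he; have [|k' [h1 h2]] := IH (bmul s (residue s p) k) (Z.of_N p * x)%Z e (rep_mul ok (rep_residue ok p) hk).
  lia.
exists k'; split=> //; rewrite pwS; have -> : (x * (pw e * Z.of_N p) = Z.of_N p * x * pw e)%Z by lia.
exact: h2.
Qed.

Lemma nth_error_combine (A B : Type) (l : list A) (l' : list B) e a b :
  nth_error l e = Some a -> nth_error l' e = Some b -> nth_error (combine l l') e = Some (a, b).
Proof. elim: e l l' => [|e IH] [|x l] [|y l'] //=; [by move=> [->] [->] | exact: IH]. Qed.

Lemma nth_error_repeat_nil (A : Type) (x : A) n e : (e < n)%nat -> nth_error (repeat x n) e = Some x.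
Proof. elim: n e => [|n IH] [|e] h //=; try lia; apply: IH; lia. Qed.

Lemma vectors_rep st n e : forallb stage_ok st = true -> (e < n)%nat ->
  exists v, nth_error (vectors st p n) e = Some v /\ Forall2 (fun s k => rep s k (pw e)) st v.
Proof.
move=> + he; elim: st => [_|s st IH /= /andb_prop [ok /IH [v [hv hf]]]].
  by exists nil; split; [exact: nth_error_repeat_nil | constructor].
have [k [hk hr]] := iterates_rep ok (rep1 ok) he.
exists (k :: v); split; last by constructor=> //; move: hr; rewrite Z.mul_1_l.
by rewrite nth_error_map (nth_error_combine hk hv).
Qed.

Lemma put_old s k v l k' vs' w : stage_ok s = true -> In (k', vs') l -> In w vs' ->
  exists vs, In (k', vs) (put s k v l) /\ In w vs.
Proof.
move=> ok; elim: l => //= [[k1 vs1] l IH] h hw; case: (isz _).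
  case: h => [[e1 e2]|h]; first by subst; exists (v :: vs'); split; [left | right].
  by exists vs'; split=> //; right.
case: h => [[e1 e2]|h]; first by subst; exists vs'; split=> //; left.
by have [vs [h1 h2]] := IH h hw; exists vs; split=> //; right.
Qed.

Lemma put_new s k v l : stage_ok s = true -> exists vs, In (k, vs) (put s k v l) /\ In v vs.
Proof.
move=> ok; elim: l => /= [|[k1 vs1] l [vs [h1 h2]]].
  by exists [v]; split; left.
case e: (isz _); first by rewrite (isz_bsub ok e); exists (v :: vs1); split; left.
by exists vs; split=> //; right.
Qed.

Lemma classify_old s vs l k us w : stage_ok s = true -> In (k, us) l -> In w us ->
  exists us', In (k, us') (classify s vs l) /\ In w us'.
Proof.
move=> ok; elim: vs l us => /= [|[|k1 v1] vs IH] l us h hw; try by exists us.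
by have [us' [h1 h2]] := put_old k1 v1 ok h hw; apply: IH h1 h2.
Qed.

Lemma classify_new s vs l k v : stage_ok s = true -> ~ In nil vs -> In (k :: v) vs ->
  exists us, In (k, us) (classify s vs l) /\ In v us.
Proof.
move=> ok; elim: vs l => //= [[|k1 v1] vs IH] l hn; first by case: hn; left.
case=> [[-> ->]|h]; last by apply: IH => // h'; apply: hn; right.
by have [us [h1 h2]] := put_new k v l ok; apply: classify_old h1 h2.
Qed.

Lemma put_length s m k1 v1 l : length v1 = m ->
  (forall (k : byte) us, In (k, us) l -> forall w, In w us -> length w = m) ->
  forall (k : byte) us, In (k, us) (put s k1 v1 l) -> forall w, In w us -> length w = m.
Proof.
move=> hv1; elim: l => /= [|[k2 vs2] l IHl] hl' k3 us3.
  by case=> // [[_ <-]] w [<-|].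
case: (isz _) => /= -[[_ <-]|h'] w hw.
- by case: hw => [<- //|hw]; apply: (hl' k2 vs2) => //; left.
- by apply: (hl' k3 us3) => //; right.
- by apply: (hl' k2 vs2) => //; left.
- by apply: (IHl _ k3 us3 h' w hw) => k4 us4 h4; apply: (hl' k4); right.
Qed.

Lemma classify_length s m vs l : (forall w, In w vs -> length w = S m) ->
  (forall (k : byte) us, In (k, us) l -> forall w, In w us -> length w = m) ->
  forall (k : byte) us, In (k, us) (classify s vs l) -> forall w, In w us -> length w = m.
Proof.
elim: vs l => [|v0 vs IH] l hl hl2 //=.
case: v0 hl => [|k1 v1] hl; first exact: hl2.
apply: IH => [w hw|]; first by apply: hl; right.
by apply: put_length => //; have := hl _ (or_introl erefl) => -[].
Qed.

(** All vectors must have the length of the chain: [classify] stops at an empty vector and would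
    drop whatever follows it. *)
Lemma build_cov st vs v x : forallb stage_ok st = true ->
  (forall w, In w vs -> length w = length st) ->
  In v vs -> Forall2 (fun s k => rep s k x) st v -> pcov st (build st vs) x.
Proof.
move=> + + + h; elim: h vs => [//|s k st' v' hk hv IH] vs /= /andb_prop [ok oks] hl hin.
have hn : ~ In nil vs by move/hl.
have [us [h1 h2]] := classify_new nil ok hn hin.
have hlen := @classify_length s (length st') vs nil hl (fun _ _ h => match h with end).
rewrite subs_pack; exists k, (build st' us); split; last first.
  by split=> //; apply: IH => //; exact: (hlen k us h1).
have: chain_subs (fold_right (fun kv t => Br (fst kv) (build st' (snd kv)) t) Stop (classify s vs nil)) =
  map (fun kv => (fst kv, build st' (snd kv))) (classify s vs nil).
  by elim: (classify s vs nil) => [|a l IHl] /=; rewrite ?IHl.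
move=> e; have: In (k, build st' us) (map (fun kv => (fst kv, build st' (snd kv))) (classify s vs nil)).
  by apply/in_map_iff; exists (k, us).
rewrite -e; generalize (fold_right (fun kv t => Br (fst kv) (build st' (snd kv)) t) Stop (classify s vs nil)).
by case.
Qed.

Lemma vectors_length st n w : In w (vectors st p n) -> length w = length st.
Proof.
elim: st w => [|s st IH] w /=; first by move=> h; rewrite (repeat_spec _ _ _ h).
move/in_map_iff => [[k v] [<- h]] /=.
by rewrite (IH v (in_combine_r _ _ _ _ h)).
Qed.

Lemma prime_tree_cov st n e : forallb stage_ok st = true -> (e < n)%nat ->
  pcov st (prime_tree st n p) (pw e).
Proof.
move=> ok he; have [v [hv hf]] := vectors_rep ok he.
apply: (build_cov ok _ (nth_error_In _ _ hv) hf) => w; exact: vectors_length.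
Qed.
End Trees.

Fixpoint modpow (m x : N) (e : positive) : N :=
  match e with
  | xH => (x mod m)%N
  | xO e => let r := modpow m x e in ((r * r) mod m)%N
  | xI e => let r := modpow m x e in (((r * r) mod m * x) mod m)%N
  end.

Lemma modpowE m x e : m <> 0%N -> modpow m x e = (x ^ N.pos e mod m)%N.
Proof.
move=> hm; elim: e => [e IH|e IH|]; cbn [modpow]; last by rewrite N.pow_1_r.
- have -> : (N.pos e~1 = N.pos e + N.pos e + 1)%N by lia.
  by rewrite IH !N.pow_add_r N.pow_1_r -N.Div0.mul_mod N.Div0.mul_mod_idemp_l.
- have -> : (N.pos e~0 = N.pos e + N.pos e)%N by lia.
  by rewrite IH N.pow_add_r -N.Div0.mul_mod.
Qed.

Definition periodic (p : N) : bool :=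
  forallb (fun s => (modpow (modulus s) p 1445 =? modpow (modulus s) p 5)%N) chain.

Lemma chain_ok : forallb stage_ok chain = true.
Proof. vm_cast_no_check (eq_refl true). Qed.

Lemma primes100_periodic : forallb periodic primes100 = true.
Proof. vm_cast_no_check (eq_refl true). Qed.

Lemma horizonE : horizon = (5 + 1440)%nat.
Proof. vm_cast_no_check (eq_refl horizon). Qed.

Opaque chain horizon.

Lemma chain_stage_ok s : In s chain -> stage_ok s = true.
Proof. by move=> h; move/forallb_forall: chain_ok; apply. Qed.

Lemma pwE p e : pw p e = Z.of_N (p ^ N.of_nat e).
Proof. by rewrite N2Z.inj_pow nat_N_Z. Qed.

Lemma pwD p e e' : pw p (e + e') = (pw p e * pw p e')%Z.
Proof. by rewrite /pw Nat2Z.inj_add Z.pow_add_r; lia. Qed.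

(** A single coincidence between the exponents [t + l] and [t] propagates to all larger ones by
    multiplication, so the period can be subtracted until the exponent is below [t + l]. *)
Lemma reduce_exponent p (t l : nat) : (0 < l)%nat ->
  (forall s, In s chain -> (pw p (t + l) mod mz s = pw p t mod mz s)%Z) ->
  forall e, exists e', (e' < t + l)%nat /\
    forall s, In s chain -> (pw p e mod mz s = pw p e' mod mz s)%Z.
Proof.
move=> hl hp e; pattern e; apply: (well_founded_ind lt_wf) => {}e IH.
case: (le_lt_dec (t + l) e) => h; last by exists e.
have [|e' [he' h']] := IH (t + (e - (t + l)))%nat; first lia.
exists e'; split=> // s hs; rewrite -h' //.
have -> : e = (t + l + (e - (t + l)))%nat by lia.
have -> : (t + l + (e - (t + l)) - (t + l) = e - (t + l))%nat by lia.
by rewrite !pwD Zmult_mod -pwD hp // -Zmult_mod.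
Qed.

Lemma pcov_mod st t x y : (forall s, In s st -> (x mod mz s = y mod mz s)%Z) ->
  pcov st t x -> pcov st t y.
Proof.
elim: st t => //= s st IH t h [k [u [hu [hk hc]]]]; exists k, u; split=> //; split.
  by rewrite /rep -h //; left.
by apply: IH hc => s' hs'; apply: h; right.
Qed.

Lemma lookup_map (f : N -> tree) p l : In p l -> lookup p (map (fun p => (p, f p)) l) = f p.
Proof.
elim: l => //= q l IH h; case: N.eqb_spec => [-> //|hn]; apply: IH.
by case: h => // h; case: hn.
Qed.

(** No bound on [e]: the trie is built from the exponents below 1445, and periodicity makes it
    exhaustive. *)
Lemma tree_of_cov p e : In p primes100 -> pcov chain (tree_of p) (pw p e).
Proof.
move=> hp; rewrite /tree_of /trees (lookup_map (prime_tree chain horizon) hp).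
have hh : horizon = (5 + 1440)%nat := horizonE.
have hper : forall s, In s chain -> (pw p (5 + 1440) mod mz s = pw p 5 mod mz s)%Z.
  move=> s hs; move/forallb_forall: primes100_periodic => /(_ p hp).
  move/forallb_forall => /(_ s hs) /N.eqb_eq.
  have [/N.ltb_lt hm _] := andb_prop _ _ (chain_stage_ok hs).
  have hm0 : modulus s <> 0%N by lia.
  rewrite !modpowE // => h; rewrite !pwE /mz -!N2Z.inj_mod; f_equal; exact: h.
have h0 : (0 < 1440)%nat by apply/Nat.ltb_lt.
have [e' [he' h]] := reduce_exponent h0 hper e.
apply: (pcov_mod (x := pw p e')); first by move=> s hs; rewrite h.
apply: prime_tree_cov; [exact: chain_ok | by rewrite hh].
Qed.

(** * Obstructions obtained from the sieve *)

Fixpoint reach (ps : list N) (S : Z) : Prop :=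
  match ps with
  | nil => S = 0%Z
  | p :: ps => exists e S', S = (pw p e + S')%Z /\ reach ps S'
  end.

Lemma positives_cov ps r S z : (forall p, In p ps -> In p primes100) ->
  reach ps S -> tcov chain r z -> tcov chain (positives ps r) (S + z).
Proof.
elim: ps S => [|p ps IH] S hp /=; first by move=> ->.
move=> [e [S' [-> hS]]] hr; exists (pw p e), (S' + z)%Z; split; first by rewrite /=; lia.
split; first by apply: cov_pcov; apply: tree_of_cov; apply: hp; left.
by apply: IH => // q hq; apply: hp; right.
Qed.

Lemma reach_split n ps S : reach ps S ->
  exists S1 S2, S = (S1 + S2)%Z /\ reach (firstn n ps) S1 /\ reach (skipn n ps) S2.
Proof.
elim: n ps S => [|n IH] [|p ps] S /=; try by move=> h; exists 0%Z, S.
move=> [e [S' [-> /IH [S1 [S2 [-> [h1 h2]]]]]]]; exists (pw p e + S1)%Z, S2.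
by split; [lia | split=> //; exists e, S1].
Qed.

Lemma chain_residues c : Forall2 (fun s k => rep s k (Z.of_N c)) chain (map (fun s => residue s c) chain).
Proof.
have: forall st, forallb stage_ok st = true ->
  Forall2 (fun s k => rep s k (Z.of_N c)) st (map (fun s => residue s c) st).
  elim=> [|s st IH] /=; first by constructor.
  by case/andb_prop => h1 h2; constructor; [exact: rep_residue | exact: IH].
by apply; exact: chain_ok.
Qed.

(** The stages are not pairwise coprime, but only one direction matters: a congruence modulo the
    product implies one modulo each stage. *)
Definition modulus_product (st : list stage) : Z := fold_right (fun s m => mz s * m)%Z 1%Z st.

Lemma modulus_product_pos st : forallb stage_ok st = true -> (0 < modulus_product st)%Z.
Proof. by elim: st => //= s st IH /andb_prop [/mz_gt1 h1 /IH h2]; nia. Qed.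

Lemma modulus_product_divide s st : In s st -> (mz s | modulus_product st)%Z.
Proof.
elim: st => //= s' st IH [->|/IH h]; first exact: Z.divide_factor_l.
exact: Z.divide_mul_r.
Qed.

Lemma modulus_product_mod x y s : In s chain ->
  (x mod modulus_product chain = y mod modulus_product chain)%Z -> (x mod mz s = y mod mz s)%Z.
Proof.
move=> hs h; have hd := modulus_product_divide hs.
have h1 := mz_gt1 (chain_stage_ok hs); have h2 := modulus_product_pos chain_ok.
rewrite (Zmod_div_mod (mz s) (modulus_product chain) x); [|lia|lia|exact: hd].
by rewrite h -Zmod_div_mod //; lia.
Qed.

Lemma modulus_product_chain : (2 <= modulus_product chain)%Z.
Proof.
have hs : In (hd (stage_of 2) chain) chain by left.
have h1 := mz_gt1 (chain_stage_ok hs); have h2 := modulus_product_pos chain_ok.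
have h3 := Z.divide_pos_le _ _ h2 (modulus_product_divide hs); lia.
Qed.

Definition solvable (ps : list N) (z c : N) : Prop :=
  exists S k, reach ps S /\ S = (pw z k + Z.of_N c)%Z.
Definition obstructed (ps : list N) (z c : N) : Prop :=
  exists m, (2 <= m)%Z /\
    forall S k, reach ps S -> (S mod m)%Z <> ((pw z k + Z.of_N c) mod m)%Z.

Lemma refutes_obstructed ps z c : (forall p, In p ps -> In p primes100) -> In z primes100 ->
  refutes ps z c = true -> obstructed ps z c.
Proof.
move=> hps hz h; exists (modulus_product chain); split; first exact: modulus_product_chain.
move=> S k hS hm; have [S1 [S2 [eS [h1 h2]]]] := reach_split (Nat.div2 (Datatypes.S (Datatypes.S (length ps)))) hS.
have hfirst : forall n p, In p (firstn n ps) -> In p primes100.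
  by move=> n p hp; apply: hps; rewrite -(firstn_skipn n ps); apply/in_or_app; left.
have hskip : forall n p, In p (skipn n ps) -> In p primes100.
  by move=> n p hp; apply: hps; rewrite -(firstn_skipn n ps); apply/in_or_app; right.
have hl := positives_cov (hfirst _) h1 (erefl : tcov chain TNil 0).
have hneg : tcov chain (TCons true (tree_of z) TNil) (- pw z k).
  exists (pw z k), 0%Z; split; first by rewrite /=; lia.
  by split=> //; apply: cov_pcov; exact: tree_of_cov.
have hr := positives_cov (hskip _) h2 hneg.
apply: (sieve_sound chain_ok (chain_residues c) h hl hr) => s hs.
have h3 := modulus_product_mod hs hm; have h4 := mz_gt1 (chain_stage_ok hs).
have -> : (S1 + 0 = S - S2)%Z by lia.
have -> : (Z.of_N c - (S2 + - pw z k) = (pw z k + Z.of_N c) - S2)%Z by lia.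
by rewrite Zminus_mod h3 -Zminus_mod.
Qed.

Definition settled (ps : list N) (z : N) : Prop :=
  forall c, (c <= 1000)%N -> solvable ps z c \/ obstructed ps z c.

(** * One or two added powers: the modulus 65520 *)

Definition is_power (p : N) (y : N * N) : Prop :=
  exists e, snd y = (p ^ N.of_nat e)%N /\ fst y = (snd y mod mult)%N.

(** Invariant of the loop: the successor of every stored residue is either stored or the current
    one. When the current residue recurs, the list is closed under multiplication by p, hence
    contains all powers of p modulo [mult]. *)
Lemma orbitP p n r x acc : orbit n p r x acc <> nil -> is_power p (r, x) ->
  (forall y, In y acc -> is_power p y) ->
  (forall y, In y acc -> r = ((fst y * p) mod mult)%N \/
     exists y', In y' acc /\ fst y' = ((fst y * p) mod mult)%N) ->
  (forall y, In y (orbit n p r x acc) -> is_power p y) /\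
  (exists y, In y (orbit n p r x acc) /\ fst y = r) /\
  (forall y, In y (orbit n p r x acc) ->
     exists y', In y' (orbit n p r x acc) /\ fst y' = ((fst y * p) mod mult)%N).
Proof.
elim: n r x acc => [//|n IH] r x acc /=.
case e: (existsb _ acc) => hn hrx hacc hcl.
  have [y [hy /N.eqb_eq hy']] := proj1 (existsb_exists _ _) e.
  split=> //; split; first by exists y.
  by move=> y1 /hcl [h|//]; exists y; split=> //; rewrite hy'.
have [|||h1 [h2 h3]] := IH _ _ _ hn.
- move: hrx => [k [/= hk hr]]; exists (S k); split.
    by change (x * p = p ^ N.of_nat (S k))%N; rewrite hk Nat2N.inj_succ N.pow_succ_r' N.mul_comm.
  by rewrite /= hr N.Div0.mul_mod_idemp_l.
- by move=> y [<-|/hacc].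
- move=> y [<-|/hcl [h|[y' [h h']]]]; first by left.
  + by right; exists (r, x); split; [left | rewrite h].
  + by right; exists y'; split=> //; right.
split=> //; split=> //.
(* Stored entries are never lost, so the starting residue belongs to the final list. *)
have: forall n r x acc y, orbit n p r x acc <> nil -> In y acc -> In y (orbit n p r x acc).
  elim=> [//|n1 IH1] r1 x1 acc1 y /=; case: (existsb _ acc1) => // hn1 hy.
  by apply: IH1 => //; right.
by move/(_ _ _ _ _ (r, x) hn (or_introl erefl)) => h; exists (r, x).
Qed.

Lemma powers100 : forallb (fun p => if powers p is nil then false else true) primes100 = true.
Proof. by vm_compute. Qed.

Lemma powers_sound p y : In p primes100 -> In y (powers p) -> is_power p y.
Proof.
move=> hp; have hn : powers p <> nil.
  by move/forallb_forall: powers100 => /(_ p hp); case: (powers p).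
have [||| h _] := orbitP hn; last exact: h.
- by exists O.
- by [].
- by [].
Qed.

Lemma powers_complete p e : In p primes100 ->
  exists y, In y (powers p) /\ fst y = (p ^ N.of_nat e mod mult)%N.
Proof.
move=> hp; have hn : powers p <> nil.
  by move/forallb_forall: powers100 => /(_ p hp); case: (powers p).
have [||| _ [[y [hy h1]] hcl]] := orbitP hn.
- by exists O.
- by [].
- by [].
elim: e => [|e [y' [hy' h']]]; first by exists y.
have [y2 [hy2 h2]] := hcl _ hy'; exists y2; split=> //.
by rewrite h2 h' N.Div0.mul_mod_idemp_l Nat2N.inj_succ N.pow_succ_r' N.mul_comm.
Qed.

Lemma sums_sound ps y : (forall p, In p ps -> In p primes100) -> In y (sums ps) ->
  (fst y < mult)%N /\ reach ps (Z.of_N (snd y)).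
Proof.
elim: ps y => [|p ps IH] y hp /=; first by case=> // <-.
move/in_flat_map => [u [hu /in_map_iff [v [<- hv]]]] /=.
have [|l1 h1] := IH v _ hv; first by move=> q hq; apply: hp; right.
have [|e [h2 h3]] := powers_sound (p := p) _ hu; first by apply: hp; left.
split; last first.
  by exists e, (Z.of_N (snd v)); split=> //; rewrite N2Z.inj_add h2 pwE.
have l2 : (fst u < mult)%N by rewrite h3; apply: N.mod_lt.
by case: N.ltb_spec => //; lia.
Qed.

Lemma sums_complete ps S : (forall p, In p ps -> In p primes100) -> reach ps S ->
  exists y, In y (sums ps) /\ Z.of_N (fst y) = (S mod Z.of_N mult)%Z.
Proof.
elim: ps S => [|p ps IH] S hp /=; first by move=> ->; exists (0, 0)%N; split=> //; left.
move=> [e [S' [-> hS]]]; have [|v [hv h1]] := IH S' _ hS; first by move=> q hq; apply: hp; right.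
have [|u [hu h2]] := powers_complete (p := p) e; first by apply: hp; left.
exists (let r := (fst u + fst v)%N in if (r <? mult)%N then r else (r - mult)%N, (snd u + snd v)%N).
split; first by apply/in_flat_map; exists u; split=> //; apply/in_map_iff; exists v.
have {}h2 : Z.of_N (fst u) = (pw p e mod Z.of_N mult)%Z by rewrite h2 N2Z.inj_mod pwE.
rewrite Zplus_mod -h1 -h2 /=.
have hm : (Z.of_N mult = 65520)%Z by [].
have b1 : (0 <= Z.of_N (fst u) < 65520)%Z by rewrite h2; apply: Z.mod_pos_bound.
have b2 : (0 <= Z.of_N (fst v) < 65520)%Z by rewrite h1; apply: Z.mod_pos_bound.
case: N.ltb_spec => h3; have h4 : mult = 65520%N by [].
  by rewrite Z.mod_small; lia.
by apply: (Z.mod_unique _ _ 1); lia.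
Qed.

Lemma fill_in (A : Type) (f : A -> byte) l (b : bucket A) y :
  In y l \/ In y (bfind (f y) b) -> In y (bfind (f y) (fold_left (fun b y => bins (f y) y b) l b)).
Proof.
elim: l b => [|x l IH] b /=; first by case.
case=> [[->|h]|h]; apply: IH; [right|by left|right]; [exact: bins_new | exact: bins_old].
Qed.

Lemma bins_inv (A : Type) k k' (x y : A) b :
  In y (bfind k' (bins k x b)) -> y = x \/ In y (bfind k' b).
Proof.
rewrite binsE !bfindE; destruct (digits k) as [[[i0 i1] i2] i3], (digits k') as [[[j0 j1] j2] j3].
rewrite sel_upd; case: (digit_eqb _ _); last by right.
rewrite sel_upd; case: (digit_eqb _ _); last by right.
rewrite sel_upd; case: (digit_eqb _ _); last by right.
by rewrite sel_upd; case: (digit_eqb _ _) => /=; [case; [left | right] | right].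
Qed.

Lemma fill_inv (A : Type) (f : A -> byte) l (b : bucket A) k y :
  In y (bfind k (fold_left (fun b y => bins (f y) y b) l b)) -> In y l \/ In y (bfind k b).
Proof.
elim: l b => [|x l IH] b /=; first by right.
move=> h0; case: (IH _ h0) => [h|h1]; first by left; right.
by case: (bins_inv h1) => [->|h]; [left; left | right].
Qed.

Lemma bfind_bempty (A : Type) k : bfind k (bempty A) = nil.
Proof. by case: k. Qed.

Lemma hits_in_intro off zr l y c : In y l -> (fst y + off = fst zr + c)%N -> (c <= 1000)%N ->
  exists b, In (c, b) (hits_in off zr l).
Proof.
move=> hy h hc; exists (snd y =? snd zr + c)%N; apply/in_flat_map; exists y; split=> //=.
have -> : (fst zr <=? fst y + off)%N = true by apply/N.leb_le; lia.
have -> : (fst y + off - fst zr = c)%N by lia.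
by move/N.leb_le: hc => ->; left.
Qed.

Lemma hits_in_elim off zr l c : In (c, true) (hits_in off zr l) ->
  exists y, In y l /\ snd y = (snd zr + c)%N.
Proof.
move/in_flat_map => [y [hy /=]]; case: (_ <=? _)%N => //; case: (_ <=? _)%N => //.
by case=> // [[<- /N.eqb_eq h]]; exists y.
Qed.

Lemma near_quotient a b c : b = (a + c)%N -> (c <= 1000)%N ->
  (b / 1024 = a / 1024 \/ b / 1024 = (a + 1024) / 1024)%N.
Proof.
move=> e hc; have n0 : 1024%N <> 0%N by [].
have -> : (a + 1024 = a + 1 * 1024)%N by lia.
rewrite N.div_add //; move: (N.div_mod a 1024 n0) (N.mod_lt a 1024 n0).
move: (N.div_mod b 1024 n0) (N.mod_lt b 1024 n0).
move: (a / 1024)%N (a mod 1024)%N (b / 1024)%N (b mod 1024)%N; lia.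
Qed.

(** Without wrap-around, [near_quotient] places the sum in one of the two neighbouring blocks. *)
Lemma hits_complete ss zs y zr c : In y ss -> In zr zs -> (fst y < mult)%N ->
  (fst zr < mult)%N -> (c <= 1000)%N -> fst y = ((fst zr + c) mod mult)%N ->
  exists b, In (c, b) (hits ss zs).
Proof.
move=> hy hz ly lz hc e.
have [b hb] : exists b, In (c, b)
   (let b := fold_left (fun b y => bins (block (fst y)) y b) ss (bempty (N * N)) in
    hits_in 0 zr (bfind (block (fst zr)) b) ++
    hits_in 0 zr (bfind (block (fst zr + 1024)) b) ++
    (if (mult <=? fst zr + 1000)%N then hits_in mult zr (bfind x00 b) else nil)).
  have hin := fill_in (f := fun y => block (fst y)) (b := bempty (N * N)) (or_introl hy).
  case: (N.lt_ge_cases (fst zr + c) mult) => h.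
    rewrite N.mod_small // in e.
    have hq := near_quotient e hc.
    have hb : block (fst y) = block (fst zr) \/ block (fst y) = block (fst zr + 1024).
      by rewrite /block !N.shiftr_div_pow2; case: hq => h'; [left|right]; congr n2b.
    have e0 : (fst y + 0 = fst zr + c)%N by lia.
    case: hb => hb; rewrite hb in hin; have [b h1] := hits_in_intro hin e0 hc; exists b.
      by apply/in_or_app; left.
    by apply/in_or_app; right; apply/in_or_app; left.
  (* Wrap-around: the quotient by 65520 is exactly 1, and the residue that remains is below 1000, so
     it lies in block 0. *)
  have e1 : (fst y + mult = fst zr + c)%N.
    have h4 : mult = 65520%N by []. rewrite h4 in h ly lz e *.
    have := N.div_mod (fst zr + c) 65520; rewrite -e; have : ((fst zr + c) / 65520 = 1)%N; last by lia.
    by symmetry; apply: (N.div_unique _ _ _ (fst zr + c - 65520)); lia.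
  have hb : block (fst y) = x00.
    rewrite /block N.shiftr_div_pow2 N.div_small //=; lia.
  rewrite hb in hin; have [b h1] := hits_in_intro hin e1 hc; exists b.
  have -> : (mult <=? fst zr + 1000)%N = true by apply/N.leb_le; lia.
  by apply/in_or_app; right; apply/in_or_app; right.
by exists b; apply/in_flat_map; exists zr.
Qed.

Lemma hits_sound ss zs c : In (c, true) (hits ss zs) ->
  exists y zr, In y ss /\ In zr zs /\ snd y = (snd zr + c)%N.
Proof.
move/in_flat_map => [zr [hz h]].
have hss : forall k off, In (c, true) (hits_in off zr (bfind k
    (fold_left (fun b y => bins (block (fst y)) y b) ss (bempty (N * N))))) ->
    exists y zr, In y ss /\ In zr zs /\ snd y = (snd zr + c)%N.
  move=> k off /hits_in_elim [y [hy e]]; exists y, zr; split=> //.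
  by case: (fill_inv (f := fun y => block (fst y)) hy) => //; rewrite bfind_bempty.
case/in_app_iff: h => [|/in_app_iff [|]]; try exact: hss.
by case: (_ <=? _)%N => //; exact: hss.
Qed.

Lemma eqlP l l' : eql l l' = true -> l = l'.
Proof.
by elim: l l' => [|x l IH] [|y l'] //=; case: N.eqb_spec => // -> /IH ->.
Qed.

Lemma witness_reach (w : list (N * N)) :
  reach (map fst w) (Z.of_N (fold_right (fun pe a => fst pe ^ snd pe + a)%N 0%N w)).
Proof.
elim: w => //= [[p e] w IH] /=; exists (N.to_nat e), (Z.of_N (fold_right (fun pe a => fst pe ^ snd pe + a)%N 0%N w)).
by split=> //; rewrite pwE N2Nat.id N2Z.inj_add.
Qed.

Lemma witness_solvable ps z w c : witness_for ps z w = true -> In c (witness_value w) ->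
  solvable ps z c.
Proof.
case: w => w [z' k]; rewrite /witness_for /witness_value /=.
case: N.eqb_spec => // -> /eqlP <-; case: N.leb_spec => // h [<-|//].
exists (Z.of_N (witness_sum (w, (z, k)))), (N.to_nat k); split; first exact: witness_reach.
by rewrite pwE N2Nat.id; lia.
Qed.

(** If [c] is hit modulo 65520, it is either solved by an orbit or a witness, or refuted by the
    sieve. *)
Lemma decided_settled ws ps z : (forall p, In p ps -> In p primes100) -> In z primes100 ->
  decided ws ps (sums ps) z = true -> settled ps z.
Proof.
move=> hps hz hd c hc; set hs := hits (sums ps) (powers z).
case e: (existsb (fun h => (fst h =? c)%N) hs).
  have [[c' b] [hin /N.eqb_eq /= ec]] := proj1 (existsb_exists _ _) e; subst c'.
  move/forallb_forall: hd => /(_ _ hin) /=; case e1: (existsb _ _) => h; last first.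
    by right; apply: refutes_obstructed.
  left; have [c' [hc' /N.eqb_eq ec]] := proj1 (existsb_exists _ _) e1; subst c'.
  case/in_app_iff: hc' => [/in_map_iff [[c1 b1] [/= e2 /filter_In [h1 /= h2]]]|]; last first.
    by move/in_flat_map => [w [/filter_In [_ hw] hv]]; apply: witness_solvable hw hv.
  subst c1; move: h1; rewrite h2 => /hits_sound [y [zr [hy [hzr ey]]]].
  have [_ hr] := sums_sound hps hy; have [k [ek _]] := powers_sound hz hzr.
  by exists (Z.of_N (snd y)), k; split=> //; rewrite ey N2Z.inj_add ek pwE.
(* A value of [c] that is never hit is excluded by 65520 alone. *)
right; exists 65520%Z; split=> // S k hS heq.
have [y [hy h1]] := sums_complete hps hS; have [ly _] := sums_sound hps hy.
have [zr [hzr h2]] := powers_complete k hz.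
have lz : (fst zr < mult)%N by rewrite h2; apply: N.mod_lt.
have [|b hb] := hits_complete hy hzr ly lz hc.
  apply: N2Z.inj; rewrite h1 N2Z.inj_mod N2Z.inj_add h2 N2Z.inj_mod -pwE Zplus_mod_idemp_l.
  exact: heq.
move: e; have -> // : existsb (fun h => (fst h =? c)%N) hs = true.
by apply/existsb_exists; exists (c, b); split=> //=; rewrite N.eqb_refl.
Qed.

Lemma decided_forP p1 : In p1 primes100 -> decided_for p1 = true ->
  (forall z, In z primes100 -> z <> p1 -> settled [p1] z) /\
  (forall p2 z, In p2 primes100 -> (p1 < p2)%N -> In z primes100 -> z <> p1 -> z <> p2 ->
     settled [p1; p2] z).
Proof.
move=> hp1 /andb_prop [/forallb_forall h1 /forallb_forall h2]; split.
  move=> z hz /N.eqb_neq hn; apply: (decided_settled (ws := witnesses1)) => //.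
    by move=> p [<-|].
  by move: (h1 z hz); rewrite hn.
move=> p2 z hp2 /N.ltb_lt hlt hz /N.eqb_neq n1 /N.eqb_neq n2.
apply: (decided_settled (ws := witnesses1)) => //; first by move=> p [<-|[<-|]].
by move: (h2 p2 hp2); rewrite hlt => /forallb_forall /(_ z hz); rewrite n1 n2.
Qed.

(** * Three to seven added powers: soundness of the bitmaps *)

Arguments reversed_bits : simpl never.
Arguments negatives : simpl never.
Arguments solved_step : simpl never.

Lemma primes30_primes100 p : In p primes30 -> In p primes100.
Proof.
have h : forallb (fun p => existsb (N.eqb p) primes100) primes30 = true by [].
move/(proj1 (forallb_forall _ _) h) => e.
by have [q [hq /N.eqb_eq ->]] := proj1 (existsb_exists _ _) e.
Qed.

(* Bit [i] of a bitmap stands for the right-hand side [1000 - i]. *)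
Definition solved_bits (z : N) (ps : list N) (d : N) : Prop :=
  forall i, N.testbit d i = true ->
    exists S k, reach ps S /\ (S + Z.of_N i = pw z k + 1000)%Z.
Definition refuted_bits (z : N) (ps : list N) (u : N) : Prop :=
  forall c, N.testbit u c = true -> obstructed ps z c.

Lemma shifts_bit n u p e0 i : N.testbit (shifts n u p (p ^ N.of_nat e0)) i = true ->
  exists e, N.testbit u (i + p ^ N.of_nat e) = true.
Proof.
elim: n e0 => [|n IH] e0 /=; first by [].
case: N.leb; last by [].
rewrite N.lor_spec N.shiftr_spec'; case e: (N.testbit u _); first by exists e0.
have -> : (p ^ N.of_nat e0 * p = p ^ N.of_nat (S e0))%N.
  by rewrite Nat2N.inj_succ N.pow_succ_r' N.mul_comm.
exact: IH.
Qed.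

Lemma union_bit (A : Type) (f : A -> N) l i : N.testbit (union f l) i = true ->
  exists y, In y l /\ N.testbit (f y) i = true.
Proof.
elim: l => [|x l IH] /=; first by [].
rewrite N.lor_spec; case e: (N.testbit (f x) i) => h0.
  by exists x; split=> //; left.
have [y [hy h]] := IH h0.
by exists y; split=> //; right.
Qed.

Lemma single_bit n i : N.testbit (N.shiftl 1 n) i = true -> i = n.
Proof. by rewrite N.shiftl_1_l N.pow2_bits_eqb => /N.eqb_eq. Qed.

Lemma splits_reach l p l' S e : In (p, l') (splits l) -> reach l' S -> reach l (pw p e + S).
Proof.
elim: l p l' S => //= q l IH p l' S [[<- <-] h|]; first by exists e, S.
move/in_map_iff => [[p1 l1] [[<- <-] h1]] /= [e1 [S1 [-> h]]].
exists e1, (pw p1 e + S1)%Z; split; [lia | exact: IH h1 h].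
Qed.

Lemma insert_reach l p S e : reach l S -> reach (insert p l) (pw p e + S).
Proof.
elim: l S => [|q l IH] S /=; first by move=> ->; exists e, 0%Z.
case: N.ltb => [[e1 [S1 [-> h]]]|[e1 [S1 [-> h]]]] /=.
  by exists e, (pw q e1 + S1)%Z; split=> //; exists e1, S1.
by exists e1, (pw p e + S1)%Z; split; [lia | exact: IH].
Qed.

(** A solution modulo m for [l] and [c] becomes one for the enlarged list and c + p^e when p^e is
    added to both sides; so the same modulus obstructs both. *)
Lemma obstructed_insert l p z c e :
  obstructed (insert p l) z (c + p ^ N.of_nat e) -> obstructed l z c.
Proof.
move=> [m [hm h]]; exists m; split=> // S k hS heq.
apply: (h (pw p e + S)%Z k); first exact: insert_reach.
rewrite N2Z.inj_add -pwE Zplus_mod heq -Zplus_mod; f_equal; lia.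
Qed.

Lemma get_bit l tab i : N.testbit (get l tab) i = true ->
  exists u, In (l, u) tab /\ N.testbit u i = true.
Proof.
elim: tab => [|[l' u] tab IH] /=; first by [].
case e: (eql l l') => h0.
  by exists u; split=> //; left; rewrite (eqlP e).
have [u' [hu h]] := IH h0.
by exists u'; split=> //; right.
Qed.

Lemma negatives_solved n z e :
  solved_bits z nil (negatives n z (z ^ N.of_nat e)).
Proof.
elim: n e => [|n IH] e i; first by [].
unfold negatives; fold negatives.
case: N.leb; last by [].
rewrite N.lor_spec; case e1: (N.testbit _ _) => h.
  by exists 0%Z, e; split=> //; rewrite (single_bit e1) pwE; lia.
apply: (IH (S e)); by rewrite Nat2N.inj_succ N.pow_succ_r' N.mul_comm.
Qed.

Definition solved_table (z : N) (tab : list (list N * N)) : Prop :=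
  forall l d, In (l, d) tab -> solved_bits z l d.

Lemma solved_step_solved z prev l : solved_table z prev -> solved_bits z l (solved_step z prev l).
Proof.
move=> hp i; rewrite /solved_step N.lor_spec => /orb_prop [] /union_bit.
  move=> [[p l'] [hl h]]; have [e h1] := shifts_bit (e0 := 0%nat) h.
  have [u [hu h2]] := get_bit h1; have [S [k [hS e1]]] := hp _ _ hu _ h2.
  exists (pw p e + S)%Z, k; split; first exact: splits_reach hl hS.
  by move: e1; rewrite /= N2Z.inj_add -pwE; lia.
move=> [[w [z' k]] [/filter_In [_]]]; rewrite /witness_for /witness_bit /=.
case: N.eqb_spec => // -> /eqlP <-; case: N.leb_spec => [h|_]; last by rewrite N.bits_0.
move/single_bit => hi.
exists (Z.of_N (witness_sum (w, (z, k)))), (N.to_nat k); split; first exact: witness_reach.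
by rewrite pwE N2Nat.id; lia.
Qed.

Lemma solved_tables_solved z qs n : Forall (solved_table z) (solved_tables z qs n).
Proof.
elim: n => [|n IH] /=.
  constructor=> //; move=> l d [[<- <-]|//]; exact: (negatives_solved (e := 0%nat)).
constructor=> //; move=> l d /in_map_iff [l' [[<- <-] _]]; apply: solved_step_solved.
by case: IH => [|t ts ht _] /=.
Qed.

(** The tables are stored by decreasing length, so the lists of length k are found at position n -
    k. *)
Lemma solved_tables_nth z qs n k l : (k <= n)%nat -> In l (sublists k qs) ->
  exists t d, nth_error (solved_tables z qs n) (n - k) = Some t /\ In (l, d) t.
Proof.
elim: n => [|n IH] hk hl.
  have e : k = O by lia.
  subst k; rewrite /=; exists [(nil, negatives 12 z 1)], (negatives 12 z 1); split=> //.
  by case: qs hl => [|q qs] [<-|//]; left.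
case: (Nat.eq_dec k (S n)) => [e|hn].
  subst k; rewrite Nat.sub_diag; set t := hd nil (solved_tables z qs n).
  exists (map (fun l => (l, solved_step z t l)) (sublists (S n) qs)), (solved_step z t l).
  by split=> //; apply/in_map_iff; exists l.
have [|t [d [h1 h2]]] := IH _ hl; first lia.
have -> : (S n - k = S (n - k))%nat by lia.
by exists t, d.
Qed.

Lemma sublists_length k qs l : In l (sublists k qs) -> length l = k.
Proof.
elim: qs k l => [|q qs IH] [|k] l //=; try by case=> // <-.
by case/in_app_iff => [/in_map_iff [l' [<- /IH /= ->]]|/IH].
Qed.

Lemma sublists_incl k qs l : In l (sublists k qs) -> incl l qs.
Proof.
elim: qs k l => [|q qs IH] [|k] l //=; try by case=> // <-.
case/in_app_iff => [/in_map_iff [l' [<- /IH h]]|/IH h].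
  by move=> x [->|/h]; [left | right].
by move=> x /h; right.
Qed.

Lemma sublists_short k qs l : In l (sublists k qs) -> (k <= length qs)%nat.
Proof.
elim: qs k l => [|q qs IH] [|k] l //=; try lia.
by case/in_app_iff => [/in_map_iff [l' [_ /IH]]|/IH]; lia.
Qed.

Lemma sorted_sublist l qs : Sorted.StronglySorted N.lt l -> Sorted.StronglySorted N.lt qs ->
  incl l qs -> In l (sublists (length l) qs).
Proof.
elim: qs l => [|q qs IH] [|a l] hl hq hi; try by left.
  by case: (hi a (or_introl erefl)).
have [hl' ha] := Sorted.StronglySorted_inv hl; have [hq' hqq] := Sorted.StronglySorted_inv hq.
have lt1 : forall x, In x l -> (a < x)%N by apply/Forall_forall.
have lt2 : forall x, In x qs -> (q < x)%N by apply/Forall_forall.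
apply/in_app_iff; case: (hi a (or_introl erefl)) => [e|ha']; [left|right].
  subst a; apply: in_map; apply: IH => // x hx; have hx' := lt1 x hx.
  by case: (hi x (or_intror hx)) => // e; lia.
apply: IH => // x hx; case: (hi x hx) => // e; have := lt2 a ha'.
by case: hx => [e1|/lt1]; lia.
Qed.

Lemma sorted_filter (f : N -> bool) l :
  Sorted.StronglySorted N.lt l -> Sorted.StronglySorted N.lt (filter f l).
Proof.
elim=> [|a l' _ IH ha] /=; first by constructor.
case: (f a) => //; constructor=> //; apply/Forall_forall => x /filter_In [hx _].
by move/Forall_forall: ha; apply.
Qed.

Lemma reversed_bits_length n d acc : length (reversed_bits n d acc) = (n + length acc)%nat.
Proof. by elim: n d acc => // n IH d acc; rewrite [reversed_bits _ _ _]/(reversed_bits n _ _) IH /=; lia. Qed.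

Lemma reversed_bits_nth n d acc j b : nth_error (reversed_bits n d acc) j = Some b ->
  (j < n)%nat -> b = N.testbit d (N.of_nat (n - 1 - j)).
Proof.
have: forall n d acc j, (n <= j)%nat -> nth_error (reversed_bits n d acc) j = nth_error acc (j - n).
  elim=> [|n1 IH1] d1 acc1 j1 hj; first by rewrite Nat.sub_0_r.
  by rewrite [reversed_bits _ _ _]/(reversed_bits n1 _ _) IH1; [have -> : (j1 - n1 = S (j1 - S n1))%nat by lia | lia].
move=> h0; elim: n d acc => [|n IH] d acc h hj; first lia.
rewrite [reversed_bits _ _ _]/(reversed_bits n _ _) in h.
case: (Nat.eq_dec j n) => [e|hn].
  subst j; rewrite h0 // Nat.sub_diag /= in h; case: h => <-.
  have -> : (S n - 1 - n = 0)%nat by lia.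
  by rewrite N.bit0_odd.
rewrite (IH _ _ h); last lia.
have -> : N.of_nat (S n - 1 - j) = (N.of_nat (n - 1 - j) + 1)%N by lia.
by rewrite -N.shiftr_spec' -N.div2_spec.
Qed.

Lemma bit_list_nth d c : (c <= 1000)%N -> exists b,
  nth_error (bit_list d) (N.to_nat c) = Some b /\ (b = true -> N.testbit d (1000 - c) = true).
Proof.
have hN : N.of_nat 1001 = 1001%N by [].
rewrite /bit_list; move: hN; set n := 1001%nat => hN hc.
case e: (nth_error _ _) => [b|]; last first.
  move/nth_error_None: e; rewrite reversed_bits_length Nat.add_0_r; lia.
exists b; split=> // hb; have hj : (N.to_nat c < n)%nat by lia.
by rewrite -hb (reversed_bits_nth e hj); f_equal; lia.
Qed.

Lemma bit_list_bound d c b : nth_error (bit_list d) (N.to_nat c) = Some b -> (c <= 1000)%N.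
Proof.
have hN : N.of_nat 1001 = 1001%N by [].
rewrite /bit_list; move: hN; set n := 1001%nat => hN e.
have : (N.to_nat c < length (reversed_bits n d nil))%nat by apply/nth_error_Some; rewrite e.
rewrite reversed_bits_length Nat.add_0_r; lia.
Qed.

Lemma undecided_spec l u c0 j : nth_error l j = Some false ->
  N.testbit u (N.of_nat j) = false -> In (c0 + N.of_nat j)%N (undecided l u c0).
Proof.
elim: l u c0 j => [|b l IH] u c0 [|j] //=.
  by move=> [->]; rewrite N.bit0_odd => ->; left; lia.
move=> h hu; have hin : In (N.succ c0 + N.of_nat j)%N (undecided l (N.div2 u) (N.succ c0)).
  apply: IH => //; rewrite N.div2_spec N.shiftr_spec' -hu; f_equal; lia.
have -> : (c0 + N.pos (Pos.of_succ_nat j) = N.succ c0 + N.of_nat j)%N by lia.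
by case: b => //; case: N.odd => //; right.
Qed.

Lemma undecided_in l u c : nth_error l (N.to_nat c) = Some false ->
  N.testbit u c = false -> In c (undecided l u 0).
Proof.
move=> h hu; have e : c = (0 + N.of_nat (N.to_nat c))%N by lia.
by rewrite [c in In c]e; apply: undecided_spec => //; rewrite N2Nat.id.
Qed.

Lemma complement_bit l c : N.testbit (complement l) c = true ->
  nth_error l (N.to_nat c) = Some false.
Proof.
elim: l c => [|b l IH] c /=; first by [].
case: (N.eq_0_gt_0_cases c) => [->|hc].
  by case: b => //; rewrite N.bit0_odd; case: complement.
have -> : c = N.succ (N.pred c) by lia.
rewrite N2Nat.inj_succ /=; case: b => h; apply: IH.
  by move: h; rewrite N.double_spec N.testbit_even_succ'.
by move: h; rewrite N.succ_double_spec N.testbit_odd_succ'.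
Qed.

Lemma inherited_refuted z qs prev l : (forall l u, In (l, u) prev -> refuted_bits z l u) ->
  refuted_bits z l (inherited qs prev l).
Proof.
move=> hp c /union_bit [p [_]]; case: existsb; first by rewrite N.bits_0.
move=> h; have [e h1] := shifts_bit (e0 := 0%nat) h; have [u [hu h2]] := get_bit h1.
by apply: obstructed_insert; exact: hp hu _ h2.
Qed.

Opaque bit_list.

(** The invariant is that [prev] marks only refuted right-hand sides. In the current table a set bit
    gives a solution, and a clear bit an obstruction, inherited or computed; the complement then
    restores the invariant. *)
Lemma descend_settled z qs n ts prev : In z primes100 ->
  Forall (solved_table z) ts ->
  (forall l u, In (l, u) prev -> refuted_bits z l u) ->
  (forall i t l d, nth_error ts i = Some t -> In (l, d) t -> incl l primes100) ->
  descend z qs n ts prev = true ->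
  forall i t l d, (i < n)%nat -> nth_error ts i = Some t -> In (l, d) t -> settled l z.
Proof.
move=> hz; elim: n ts prev => [|n IH] [|t ts] prev hts hprev hinc hd i t1 l d hi; try by lia.
  by case: i hi.
move: hd; cbn [descend]; cbv zeta; case e: (forallb _ _) => // hd.
have ht : solved_table z t by inversion hts.
have key : forall l d, In (l, d) t -> forall c, (c <= 1000)%N ->
    N.testbit d (1000 - c) = true -> solvable l z c.
  move=> l1 d1 h1 c hc h; have [S [k [hS e1]]] := ht _ _ h1 _ h; exists S, k; split=> //; lia.
have key' : forall l d, In (l, d) t -> forall c,
    nth_error (bit_list d) (N.to_nat c) = Some false -> obstructed l z c.
  move=> l1 d1 h1 c h.
  case eb: (N.testbit (inherited qs prev l1) c); first exact: inherited_refuted eb.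
  have hin := undecided_in h eb.
  move/forallb_forall: e => /(_ (l1, bit_list d1)); cbn [fst snd].
  have hm : In (l1, bit_list d1) (map (fun ld : list N * N => (fst ld, bit_list (snd ld))) t).
    exact: (in_map (fun ld : list N * N => (fst ld, bit_list (snd ld))) _ _ h1).
  move/(_ hm)/forallb_forall/(_ _ hin) => hr.
  exact: (refutes_obstructed (hinc O t l1 d1 erefl h1) hz hr).
case: i hi => [|i] hi; cbn [nth_error].
  move=> [<-] hl c hc; have [b [eb hb]] := bit_list_nth d hc.
  case: b eb hb => eb hb; [left | right]; [apply: (key _ _ hl) => //; exact: hb | exact: key' hl _ eb].
apply: (IH _ _ _ _ _ hd) => //; first by inversion hts.
- clear e hd; move=> l1 u1 /in_map_iff [[l2 bs] [[<- <-] /in_map_iff [[l3 d3] [[<- <-] h3]]]] c hb.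
  exact: (key' _ _ h3 _ (complement_bit hb)).
- by move=> i1 t2 l2 d2 h1; apply: (hinc (S i1)).
- by lia.
Qed.

(** The [n - 2] levels treated by [decided2] are the lengths from n down to 3. *)
Lemma decided2_settled z l : In z primes100 -> decided2 z = true ->
  Sorted.StronglySorted N.lt l -> (3 <= length l <= 7)%nat ->
  (forall p, In p l -> In p primes30 /\ (p < z)%N) -> settled l z.
Proof.
move=> hz; rewrite /decided2; set qs := filter _ _; set n := Nat.min _ _ => hd hs hk hp.
have hl : In l (sublists (length l) qs).
  apply: sorted_sublist => //; last first.
    by move=> p /hp [h1 h2]; apply/filter_In; split=> //; apply/N.ltb_lt.
  by apply: sorted_filter; rewrite /primes30; repeat constructor.
have hn : (length l <= n)%nat by have := sublists_short hl; rewrite /n; lia.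
have [t [d [h1 h2]]] := solved_tables_nth z hn hl.
apply: (descend_settled hz (solved_tables_solved z qs n) _ _ hd _ h1 h2) => //; last lia.
have: forall m, forall t l d, In t (solved_tables z qs m) -> In (l, d) t -> incl l qs.
  elim=> [|m IH] t1 l1 d1 /=; first by case=> // <- [[<- _]|//].
  by case=> [<- /in_map_iff [l2 [[<- _] /sublists_incl]]|/IH]; last by apply.
move=> hincl i1 t1 l1 d1 h3 hl1 p hp0.
have /filter_In [hp1 _] := hincl _ _ _ _ (nth_error_In _ _ h3) hl1 _ hp0.
exact: primes30_primes100.
Qed.

(** * Sums of products of two powers *)

Definition product (p q : N) (x : Z) : Prop := exists a b, x = (pw p a * pw q b)%Z.

Definition settled3 (p1 p2 p3 p4 p5 p6 : N) : Prop :=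
  forall c, (c <= 1000)%N ->
  (exists x y w, product p1 p2 x /\ product p3 p4 y /\ product p5 p6 w /\
     (x + y = w + Z.of_N c)%Z) \/
  (exists m, (2 <= m)%Z /\ forall x y w, product p1 p2 x -> product p3 p4 y -> product p5 p6 w ->
     ((x + y) mod m)%Z <> ((w + Z.of_N c) mod m)%Z).

Lemma force_cov n st t x : forallb stage_ok st = true -> cov st t x ->
  cov st (force (firstn n st) t) x.
Proof.
elim: n st t x => [|n IH] [|s st] t x //= /andb_prop [ok hst] h.
have [k [u [hu [hk hc]]]] := opened_cov ok h.
left; exists k, (force (firstn n st) u); split; last by split=> //; exact: IH.
have {}hu : In (k, u) (chain_subs (unpack (expand s t))).
  by rewrite chain_subs_unpack; case: t {h} hu.
rewrite subs_pack; elim: (unpack _) hu => //= k1 u1 _ n1 IH1.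
have e : forall t, subs ((fix loop (t : tree) : tree := match t with
    | Br k u t => Br k (force (firstn n st) u) (loop t) | _ => Stop end) t) =
    chain_subs ((fix loop (t : tree) : tree := match t with
    | Br k u t => Br k (force (firstn n st) u) (loop t) | _ => Stop end) t) by case.
by case=> [[-> ->]|/IH1 h1]; [left | right; rewrite -e].
Qed.

Lemma primes13_primes100 p : In p primes13 -> In p primes100.
Proof.
have h : forallb (fun p => existsb (N.eqb p) primes100) primes13 = true by [].
move/(proj1 (forallb_forall _ _) h) => e.
by have [q [hq /N.eqb_eq ->]] := proj1 (existsb_exists _ _) e.
Qed.

(** Unique factorization for the pairs at hand: p * q is a faithful key for the table
    [product_trees]. *)
Lemma product_keys : forallb (fun y => forallb (fun y' =>
  implb (fst y * snd y =? fst y' * snd y')%N ((fst y =? fst y') && (snd y =? snd y'))%N) pairs13)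
  pairs13 = true.
Proof. by vm_compute. Qed.

Lemma lookup_key (f : N * N -> tree) y l : In y l ->
  (forall y', In y' l -> (fst y * snd y)%N = (fst y' * snd y')%N -> y = y') ->
  lookup (fst y * snd y)%N (map (fun y => ((fst y * snd y)%N, f y)) l) = f y.
Proof.
elim: l => //= y' l IH h hk; case: N.eqb_spec => [e|hn]; first by rewrite (hk y') //; left.
apply: IH; first by case: h => // h; case: hn; rewrite h.
by move=> y1 hy; apply: hk; right.
Qed.

Lemma lookup_product p q : In (p, q) pairs13 -> lookup (p * q)%N product_trees = product_tree p q.
Proof.
move=> h; rewrite /product_trees.
apply: (lookup_key (fun y => product_tree (fst y) (snd y)) h) => [[p' q']] h' /N.eqb_eq e.
move/forallb_forall: product_keys => /(_ _ h) /forallb_forall /(_ _ h'); rewrite e.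
by case/andb_prop => /N.eqb_eq /= -> /N.eqb_eq /= ->.
Qed.

Lemma product_cov p q x : In p primes13 -> In q primes13 -> (p < q)%N -> product p q x ->
  cov chain (lookup (p * q)%N product_trees) x.
Proof.
move=> hp hq hlt [a [b ->]]; rewrite lookup_product; last first.
  apply/in_flat_map; exists p; split=> //; apply/in_map_iff; exists q; split=> //.
  by apply/filter_In; split=> //; apply/N.ltb_lt.
apply: force_cov; first exact: chain_ok.
apply: cov_qcov; exists (tree_of p), (tree_of q), (pw p a), (pw q b); split; first by left.
by split=> //; split; apply: tree_of_cov; exact: primes13_primes100.
Qed.

Lemma multiples_power n x p bound y : In y (multiples n x p bound) ->
  exists e, y = (x * p ^ N.of_nat e)%N.
Proof.
elim: n x => //= n IH x; case: N.leb => //= -[<-|/IH [e ->]].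
  by exists 0%nat; rewrite N.mul_1_r.
by exists (S e); rewrite Nat2N.inj_succ N.pow_succ_r' N.mul_assoc.
Qed.

Lemma products_below_product p q bound x : In x (products_below p q bound) ->
  product p q (Z.of_N x).
Proof.
move/in_flat_map => [y [/multiples_power [a ->] /multiples_power [b ->]]].
by exists a, b; rewrite !pwE N.mul_1_l N2Z.inj_mul.
Qed.

Lemma product_pow p q a b : product p q (Z.of_N (p ^ a * q ^ b)).
Proof. by exists (N.to_nat a), (N.to_nat b); rewrite !pwE !N2Nat.id N2Z.inj_mul. Qed.

Lemma witness3_bit_product p1 p2 p3 p4 p5 p6 es i :
  N.testbit (witness3_bit [p1; p2; p3; p4; p5; p6] es) i = true ->
  exists x y w, product p1 p2 x /\ product p3 p4 y /\ product p5 p6 w /\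
     (x + y + Z.of_N i = w + 1000)%Z.
Proof.
rewrite /witness3_bit; case: es => [|e1 [|e2 [|e3 [|e4 [|e5 [|e6 [|]]]]]]]; rewrite ?N.bits_0 //.
case: N.leb_spec => [h /single_bit ->|_]; last by rewrite N.bits_0.
have h1 := product_pow p1 p2 e1 e2; have h2 := product_pow p3 p4 e3 e4.
have h3 := product_pow p5 p6 e5 e6.
exists (Z.of_N (p1 ^ e1 * p2 ^ e2)), (Z.of_N (p3 ^ e3 * p4 ^ e4)), (Z.of_N (p5 ^ e5 * p6 ^ e6)).
by do 3!split=> //; lia.
Qed.

Lemma decided3_settled p1 p2 p3 p4 p5 p6 ws :
  decided3 ([p1; p2; p3; p4; p5; p6], ws) = true ->
  incl [p1; p2; p3; p4; p5; p6] primes13 -> (p1 < p2)%N -> (p3 < p4)%N -> (p5 < p6)%N ->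
  settled3 p1 p2 p3 p4 p5 p6.
Proof.
move=> hd hp h12 h34 h56; move: hd.
have hin : forall p, In p [p1; p2; p3; p4; p5; p6] -> In p primes13 by [].
have cx : forall x, product p1 p2 x -> cov chain (lookup (p1 * p2)%N product_trees) x.
  by move=> x; apply: product_cov => //; apply: hin; rewrite /=; tauto.
have cy : forall x, product p3 p4 x -> cov chain (lookup (p3 * p4)%N product_trees) x.
  by move=> x; apply: product_cov => //; apply: hin; rewrite /=; tauto.
have cw : forall x, product p5 p6 x -> cov chain (lookup (p5 * p6)%N product_trees) x.
  by move=> x; apply: product_cov => //; apply: hin; rewrite /=; tauto.
rewrite /decided3; cbn [fst snd]; cbv zeta; set d := N.lor _ _ => hd c hc.
(* Each right shift in [d] accounts for one added product, and the initial bit w + 1000 for the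
   subtracted one. *)
have hbit : forall i, N.testbit d i = true -> exists x y w,
    product p1 p2 x /\ product p3 p4 y /\ product p5 p6 w /\ (x + y + Z.of_N i = w + 1000)%Z.
  move=> i; rewrite /d N.lor_spec => /orb_prop [] /union_bit; last first.
    by move=> [w [_ /witness3_bit_product]].
  move=> [x [/products_below_product hx]]; rewrite N.shiftr_spec' => /union_bit.
  move=> [y [/products_below_product hy]]; rewrite N.shiftr_spec' => /union_bit.
  move=> [w [/products_below_product hw /single_bit e]].
  exists (Z.of_N x), (Z.of_N y), (Z.of_N w); split; first exact: hx.
  split; first exact: hy.
  by split; [exact: hw | clear -e; lia].
have [b [eb hb]] := bit_list_nth d hc; case: b eb hb => eb hb.
- left; have [x [y [w [hx [hy [hw e]]]]]] := hbit _ (hb erefl).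
  exists x, y, w; split; first exact: hx.
  split; first exact: hy.
  by split; [exact: hw | clear -e hc; lia].
- right; have hu := undecided_in eb (N.bits_0 c).
  move/forallb_forall: hd => /(_ _ hu) hs.
  exists (modulus_product chain); split; first exact: modulus_product_chain.
  move=> x y w hx hy hw hm.
  apply: (sieve_sound (y := (x + y)%Z) (z := (- w)%Z) chain_ok (chain_residues c) hs).
  + exists x, y; split; first by rewrite /=; lia.
    split; first exact: cx.
    exists y, 0%Z; split; first by rewrite /=; lia.
    by split; first exact: cy.
  + exists w, 0%Z; split; first by rewrite /=; lia.
    by split; first exact: cw.
  move=> s hs'; have -> : (Z.of_N c - - w = w + Z.of_N c)%Z by lia.
  exact: modulus_product_mod.
Qed.

(** * Reduction to the cases computed, by symmetry *)

Lemma settled3_swap1 p1 p2 p3 p4 p5 p6 : settled3 p1 p2 p3 p4 p5 p6 -> settled3 p2 p1 p3 p4 p5 p6.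
Proof.
have sw p q x : product p q x -> product q p x by move=> [a [b ->]]; exists b, a; lia.
move=> h c /h [[x [y [w [/sw hx hs]]]]|[m [hm hs]]]; [left; by exists x, y, w | right].
by exists m; split=> // x y w /sw; exact: hs.
Qed.

Lemma settled3_swap3 p1 p2 p3 p4 p5 p6 : settled3 p1 p2 p3 p4 p5 p6 -> settled3 p1 p2 p3 p4 p6 p5.
Proof.
have sw p q x : product p q x -> product q p x by move=> [a [b ->]]; exists b, a; lia.
move=> h c /h [[x [y [w [hx [hy [/sw hw hs]]]]]]|[m [hm hs]]]; [left; by exists x, y, w | right].
by exists m; split=> // x y w hx hy /sw; exact: hs.
Qed.

Lemma settled3_swap p1 p2 p3 p4 p5 p6 : settled3 p1 p2 p3 p4 p5 p6 -> settled3 p3 p4 p1 p2 p5 p6.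
Proof.
move=> h c /h [[x [y [w [hx [hy [hw hs]]]]]]|[m [hm hs]]]; [left | right].
  by exists y, x, w; do 3!split=> //; lia.
by exists m; split=> // x y w hx hy hw; rewrite Z.add_comm; exact: hs.
Qed.

Lemma settled_swap p1 p2 z : settled [p1; p2] z -> settled [p2; p1] z.
Proof.
have sw q1 q2 S : reach [q1; q2] S -> reach [q2; q1] S.
  move=> [e [S1 [-> [e' [S2 [-> ->]]]]]]; exists e', (pw q1 e + 0)%Z.
  by split; [lia | exists e, 0%Z].
move=> h c /h [[S [k [/sw hS e]]]|[m [hm hs]]]; first by left; exists S, k.
by right; exists m; split=> // S k /sw; exact: hs.
Qed.

Lemma settled1 p z : In p primes100 -> In z primes100 -> z <> p -> settled [p] z.
Proof.
move=> hp hz hn; move/forallb_forall: all_decided_for => /(_ p hp) h.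
exact: (proj1 (decided_forP hp h)).
Qed.

Lemma settled2 p1 p2 z : In p1 primes100 -> In p2 primes100 -> In z primes100 ->
  p1 <> p2 -> z <> p1 -> z <> p2 -> settled [p1; p2] z.
Proof.
move=> h1 h2 hz hn hz1 hz2.
have wl q1 q2 : In q1 primes100 -> In q2 primes100 -> (q1 < q2)%N -> z <> q1 -> z <> q2 ->
    settled [q1; q2] z.
  move=> hq1 hq2 hlt hn1 hn2; move/forallb_forall: all_decided_for => /(_ q1 hq1) h.
  exact: (proj2 (decided_forP hq1 h)).
have [hlt|hlt] : (p1 < p2 \/ p2 < p1)%N by lia.
  exact: wl.
by apply: settled_swap; exact: wl.
Qed.

Definition settled_list (s : list N) : Prop :=
  match s with
  | [p1; p2; p3; p4; p5; p6] => settled3 p1 p2 p3 p4 p5 p6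
  | _ => False
  end.

Definition well_formed (s : list N) : bool :=
  match s with
  | [p1; p2; p3; p4; p5; p6] =>
    forallb (fun p => existsb (N.eqb p) primes13) s &&
    ((p1 <? p2)%N && (p3 <? p4)%N && (p5 <? p6)%N)
  | _ => false
  end.

Lemma pairings_well_formed : forallb well_formed (map fst pairings) = true.
Proof. by vm_compute. Qed.

Lemma pairings_settled s : In s (map fst pairings) -> settled_list s.
Proof.
move/in_map_iff => [[s' ws] [<- hin]]; cbn [fst].
move/forallb_forall: pairings_well_formed => /(_ _ (in_map fst _ _ hin)) hw.
move/forallb_forall: all_decided3 => /(_ _ hin) hd; move: hw hd; clear hin s.
case: s' => [|p1 [|p2 [|p3 [|p4 [|p5 [|p6 [|? ?]]]]]]]; try (move=> e; discriminate e).
move=> + hd; rewrite /well_formed => /andb_prop [/forallb_forall hp /andb_prop [/andb_prop [h12 h34] h56]].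
apply: (decided3_settled hd); try by apply/N.ltb_lt.
by move=> p /hp /existsb_exists [q [hq /N.eqb_eq ->]].
Qed.

Definition canonical (s : list N) : list N :=
  match s with
  | [p1; p2; p3; p4; p5; p6] =>
    let u := if (p1 <? p2)%N then (p1, p2) else (p2, p1) in
    let v := if (p3 <? p4)%N then (p3, p4) else (p4, p3) in
    let w := if (p5 <? p6)%N then (p5, p6) else (p6, p5) in
    let uv := if (fst u <? fst v)%N then (u, v) else (v, u) in
    [fst (fst uv); snd (fst uv); fst (snd uv); snd (snd uv); fst w; snd w]
  | _ => nil
  end.

(** The normal form is reached by exchanging primes inside a pair and exchanging the two added
    pairs, operations that preserve [settled3]. *)
Lemma canonical_settled s : existsb (eql (canonical s)) (map fst pairings) = true ->
  settled_list s.
Proof.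
move/existsb_exists => [s' [/pairings_settled + /eqlP e]]; rewrite -{s'}e.
case: s => [|p1 [|p2 [|p3 [|p4 [|p5 [|p6 [|]]]]]]] //; rewrite /canonical.
have sw1 := @settled3_swap1; have sw3 := @settled3_swap3; have sw := @settled3_swap.
case: (p1 <? p2)%N; case: (p3 <? p4)%N; case: (p5 <? p6)%N; cbn [fst snd];
  case: (_ <? _)%N; cbn [fst snd settled_list] => h; auto 8.
Qed.

Lemma obstructed_55191 : obstructed [2; 3; 5; 7; 11; 13; 17; 19]%N 23 55191.
Proof.
apply: refutes_obstructed refutes_55191; last by do 8 right; left.
by move=> p hp; rewrite /primes100; move: hp => /=; tauto.
Qed.

(** * Passage to the integers and sums of the statement *)

(** The Hasse-type property for a set of values over [Z], with the right-hand side moved to the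
    left; it is the common interface between the computations and [hasse_prop]. *)
Definition dichotomy (P : Z -> Prop) : Prop :=
  P 0%Z \/ exists m, (2 <= m)%Z /\ forall x, P x -> (x mod m)%Z <> 0%Z.

Lemma sub_mod_zero m x y : ((x - y) mod m = 0)%Z -> (x mod m = y mod m)%Z.
Proof.
move=> h; have -> : x = (y + (x - y))%Z by lia.
by rewrite Zplus_mod h Z.add_0_r Zmod_mod.
Qed.

Definition linear_values (ps : list N) (z c : N) (x : Z) : Prop :=
  exists S k, reach ps S /\ x = (S - (pw z k + Z.of_N c))%Z.

Lemma linear_dichotomy ps z c : solvable ps z c \/ obstructed ps z c ->
  dichotomy (linear_values ps z c).
Proof.
case=> [[S [k [hS e]]]|[m [hm h]]]; first by left; exists S, k; split=> //; lia.
by right; exists m; split=> // x [S [k [hS ->]]] /sub_mod_zero; exact: h.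
Qed.

Definition product_values (s : list N) (c : N) (x : Z) : Prop :=
  match s with
  | [p1; p2; p3; p4; p5; p6] => exists u v w,
      product p1 p2 u /\ product p3 p4 v /\ product p5 p6 w /\ x = (u + v - (w + Z.of_N c))%Z
  | _ => False
  end.

Lemma product_dichotomy s c : settled_list s -> (c <= 1000)%N -> dichotomy (product_values s c).
Proof.
case: s => [|p1 [|p2 [|p3 [|p4 [|p5 [|p6 [|]]]]]]] // h hc.
case: (h c hc) => [[u [v [w [hu [hv [hw e]]]]]]|[m [hm hs]]]; [left | right].
  by exists u, v, w; do 3!split=> //; lia.
exists m; split=> // x [u [v [w [hu [hv [hw ->]]]]]] /sub_mod_zero; exact: hs.
Qed.

Lemma pw_0 p : pw p 0 = 1%Z.
Proof. by []. Qed.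

Lemma not_small_prime30 z : In z primes30 -> (5 < z)%N -> In z (skipn 3 primes30).
Proof. by rewrite /primes30 /=; lia. Qed.

From mathcomp Require Import all_boot all_order all_algebra zify ssrZ.
Import Order.TTheory GRing.Theory Num.Theory.
Local Open Scope ring_scope.

Lemma pw_zpow p e : pw (N.of_nat p) e = Z_of_int (zpow p e).
Proof.
elim: e => [|e IH]; first by rewrite pw_0 /zpow expn0.
by rewrite pwS IH /zpow expnS; lia.
Qed.

(** The two hypotheses on [P] say that it is exactly the set of values of F - c. *)
Lemma hasse_intro F (c : nat) (P : Z -> Prop) : dichotomy P ->
  (forall a, P (Z.sub (Z_of_int (F a)) (Z.of_nat c))) ->
  (forall x, P x -> exists a, x = Z.sub (Z_of_int (F a)) (Z.of_nat c)) ->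
  hasse_prop F (Posz c).
Proof.
move=> hd h1 h2; case: hd => [/h2 [a e]|[m [hm hs]]]; first by left; exists a; lia.
right; exists (Z.to_nat m); split; first by lia.
move=> a /eqP; rewrite eqz_mod_dvd => /dvdzP [q e]; apply: (hs _ (h1 a)).
have -> : Z.sub (Z_of_int (F a)) (Z.of_nat c) = Z.mul (Z_of_int q) m by lia.
exact: Z_mod_mult.
Qed.

Lemma hasse_ext F G c : F =1 G -> hasse_prop F c -> hasse_prop G c.
Proof.
move=> h [[a e]|[m [hm hs]]]; first by left; exists a; rewrite -h.
by right; exists m; split=> // a; rewrite -h; exact: hs.
Qed.

Lemma Z_of_intD (x y : int) : Z_of_int (x + y) = Z.add (Z_of_int x) (Z_of_int y).
Proof. by lia. Qed.

Lemma reach_sum (ps : seq nat) (a : nat -> nat) : reach (List.map N.of_nat ps)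
  (Z_of_int (\sum_(0 <= i < size ps) zpow (nth 0%N ps i) (a i))).
Proof.
elim: ps a => [|p ps IH] a; first by rewrite big_geq.
have -> : size (p :: ps) = (size ps).+1 by [].
rewrite big_nat_recl //; exists (a 0%N), (Z_of_int (\sum_(0 <= i < size ps)
  zpow (nth 0%N ps i) (a i.+1))); split; last exact: (IH (fun i => a i.+1)).
by rewrite pw_zpow; exact: Z_of_intD.
Qed.

Lemma sum_reach (ps : seq nat) S : reach (List.map N.of_nat ps) S ->
  exists a : nat -> nat, S = Z_of_int (\sum_(0 <= i < size ps) zpow (nth 0%N ps i) (a i)).
Proof.
elim: ps S => [|p ps IH] S; first by move=> ->; exists (fun=> 0%N); rewrite big_geq.
move=> [e [S' [-> /IH [a ->]]]]; exists (fun i => if i is j.+1 then a j else e).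
have -> : size (p :: ps) = (size ps).+1 by [].
by rewrite big_nat_recl // pw_zpow; symmetry; exact: Z_of_intD.
Qed.

Lemma hasse_linear (ps : seq nat) (z c : nat) :
  dichotomy (linear_values (List.map N.of_nat ps) (N.of_nat z) (N.of_nat c)) ->
  hasse_prop (fun a => \sum_(0 <= i < size ps) zpow (nth 0%N ps i) (a i)
                       - zpow z (a (size ps))) (Posz c).
Proof.
move=> hd; apply: (hasse_intro hd) => [a|x [S [k [/sum_reach [a ->] ->]]]].
  exists (Z_of_int (\sum_(0 <= i < size ps) zpow (nth 0%N ps i) (a i))), (a (size ps)).
  by split; [exact: reach_sum | rewrite pw_zpow; lia].
(* The exponent of the subtracted power sits just after those of the sum, at index [size ps]. *)
exists (fun i => if (i < size ps)%N then a i else k); rewrite ltnn.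
have -> : \sum_(0 <= i < size ps) zpow (nth 0%N ps i) (if (i < size ps)%N then a i else k) =
    \sum_(0 <= i < size ps) zpow (nth 0%N ps i) (a i).
  by apply: eq_big_nat => i /andP [_ ->].
by rewrite pw_zpow; lia.
Qed.

Lemma hasse_products (s : seq nat) (c : nat) : size s = 6 ->
  dichotomy (product_values (List.map N.of_nat s) (N.of_nat c)) ->
  hasse_prop (fun a =>
        zpow (nth 0%N s 0) (a 0%N) * zpow (nth 0%N s 1) (a 1%N)
      + zpow (nth 0%N s 2) (a 2%N) * zpow (nth 0%N s 3) (a 3%N)
      - zpow (nth 0%N s 4) (a 4%N) * zpow (nth 0%N s 5) (a 5%N)) (Posz c).
Proof.
case: s => [|p1 [|p2 [|p3 [|p4 [|p5 [|p6 [|]]]]]]] // _ hd; apply: (hasse_intro hd).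
  move=> a /=; exists (Z_of_int (zpow p1 (a 0%N) * zpow p2 (a 1%N))),
    (Z_of_int (zpow p3 (a 2%N) * zpow p4 (a 3%N))), (Z_of_int (zpow p5 (a 4%N) * zpow p6 (a 5%N))).
  split; first by exists (a 0%N), (a 1%N); rewrite !pw_zpow; lia.
  split; first by exists (a 2%N), (a 3%N); rewrite !pw_zpow; lia.
  split; first by exists (a 4%N), (a 5%N); rewrite !pw_zpow; lia.
  by lia.
move=> x [u [v [w [[a1 [a2 ->]] [[a3 [a4 ->]] [[a5 [a6 ->]] ->]]]]]].
by exists (nth 0%N [:: a1; a2; a3; a4; a5; a6]); rewrite /= !pw_zpow; lia.
Qed.

Lemma primes_below (n : nat) (l : list N) :
  all (fun p => prime p ==> List.existsb (N.eqb (N.of_nat p)) l) (iota 0 n) ->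
  forall p, prime p -> (p < n)%N -> List.In (N.of_nat p) l.
Proof.
move=> /allP h p hp hn; have := h p; rewrite mem_iota hn hp => /(_ isT).
by move/existsb_exists => [q [hq /N.eqb_eq ->]].
Qed.

Lemma in_primes100 p : prime p -> (p < 100)%N -> List.In (N.of_nat p) primes100.
Proof. by apply: primes_below; vm_compute. Qed.

Lemma in_primes30 p : prime p -> (p < 30)%N -> List.In (N.of_nat p) primes30.
Proof. by apply: primes_below; vm_compute. Qed.

Lemma in_mkseq (p : nat -> nat) n x : List.In x (List.map N.of_nat (mkseq p n)) ->
  exists2 i, (i < n)%N & x = N.of_nat (p i).
Proof.
elim: n p => [|n IH] p //; rewrite /mkseq /= => -[<-|]; first by exists 0%N.
rewrite -[1%N]/(1 + 0)%N iotaDl -map_comp => /(IH (fun i => p i.+1)) [i hi ->].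
by exists i.+1.
Qed.

Lemma sorted_mkseq (p : nat -> nat) n : (forall i j, (i < j)%N -> (j < n)%N -> (p i < p j)%N) ->
  Sorted.StronglySorted N.lt (List.map N.of_nat (mkseq p n)).
Proof.
elim: n p => [|n IH] p h; first exact: Sorted.SSorted_nil.
have -> : mkseq p n.+1 = p 0%N :: mkseq (fun i => p i.+1) n.
  by rewrite /mkseq /= -[1%N]/(1 + 0)%N iotaDl -map_comp.
apply: Sorted.SSorted_cons; first by apply: IH => i j hij hj; apply: h.
by apply/Forall_forall => x /in_mkseq [i hi ->]; have := h 0%N i.+1 isT hi; lia.
Qed.

(** All 720 orders of the six primes are normalized and looked up among the 45 pairings. *)
Lemma permutations_canonical :
  all (fun s => List.existsb (eql (canonical (List.map N.of_nat s))) (List.map fst pairings))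
    (permutations [:: 2; 3; 5; 7; 11; 13]%N).
Proof. by vm_compute. Qed.

Theorem theorem3 :
  (* (1a) *)
  (forall (p1 p2 : nat) (c : nat),
     prime p1 -> prime p2 -> (p1 < 100)%N -> (p2 < 100)%N -> p1 <> p2 ->
     (c <= 1000)%N ->
     hasse_prop (fun a => zpow p1 (a 0%N) - zpow p2 (a 1%N)) (Posz c)) /\
  (* (1b) *)
  (forall (p1 p2 p3 : nat) (c : nat),
     prime p1 -> prime p2 -> prime p3 ->
     (p1 < 100)%N -> (p2 < 100)%N -> (p3 < 100)%N ->
     p1 <> p2 -> p1 <> p3 -> p2 <> p3 ->
     (c <= 1000)%N ->
     hasse_prop (fun a => zpow p1 (a 0%N) + zpow p2 (a 1%N) - zpow p3 (a 2%N))
                (Posz c)) /\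
  (* (2): p i = p_{i+1}, i < t *)
  (forall (t : nat) (p : nat -> nat) (c : nat),
     (4 <= t <= 8)%N ->
     (forall i, (i < t)%N -> prime (p i) /\ (p i < 30)%N) ->
     (forall i j, (i < j)%N -> (j < t)%N -> (p i < p j)%N) ->
     (c <= 1000)%N ->
     hasse_prop (fun a => \sum_(0 <= i < t.-1) zpow (p i) (a i)
                          - zpow (p t.-1) (a t.-1)) (Posz c)) /\
  (* (3): s = [:: p1; ...; p6] *)
  (forall (s : seq nat) (c : nat),
     perm_eq s [:: 2; 3; 5; 7; 11; 13]%N ->
     (c <= 1000)%N ->
     hasse_prop (fun a =>
        zpow (nth 0%N s 0) (a 0%N) * zpow (nth 0%N s 1) (a 1%N)
      + zpow (nth 0%N s 2) (a 2%N) * zpow (nth 0%N s 3) (a 3%N)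
      - zpow (nth 0%N s 4) (a 4%N) * zpow (nth 0%N s 5) (a 5%N)) (Posz c)) /\
  (* (4) *)
  hasse_prop (fun a =>
      zpow 2 (a 0%N) + zpow 3 (a 1%N) + zpow 5 (a 2%N) + zpow 7 (a 3%N)
    + zpow 11 (a 4%N) + zpow 13 (a 5%N) + zpow 17 (a 6%N) + zpow 19 (a 7%N)
    - zpow 23 (a 8%N)) (Posz 55191%N).
Proof.
have le1000 c : (c <= 1000)%N -> N.le (N.of_nat c) 1000 by lia.
split; [|split; [|split; [|split]]].
- move=> p1 p2 c h1 h2 l1 l2 hn hc.
  have hs : settled [N.of_nat p1] (N.of_nat p2).
    by apply: settled1; [exact: in_primes100 | exact: in_primes100 | lia].
  have := hasse_linear (ps := [:: p1]) (linear_dichotomy (hs _ (le1000 _ hc))).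
  by apply: hasse_ext => a /=; rewrite big_nat1.
- move=> p1 p2 p3 c h1 h2 h3 l1 l2 l3 n12 n13 n23 hc.
  have hs : settled [N.of_nat p1; N.of_nat p2] (N.of_nat p3).
    by apply: settled2; try exact: in_primes100; lia.
  have := hasse_linear (ps := [:: p1; p2]) (linear_dichotomy (hs _ (le1000 _ hc))).
  by apply: hasse_ext => a /=; rewrite big_nat_recr // big_nat1.
- move=> t p c /andP [ht ht'] hp hlt hc; set n := t.-1.
  have hnt i : (i < n)%N -> (i < t)%N by rewrite /n; lia.
  (* The largest prime is at least 7: four increasing integers from 2 up to at most 5 would force
     the third to be 4. This matches the primes 7 to 29 treated in [all_decided2]. *)
  have hz : (5 < p n)%N.
    have a0 := prime_gt1 (proj1 (hp 0%N ltac:(lia))).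
    have a1 := hlt 0%N 1%N isT ltac:(lia); have a2 := hlt 1%N 2%N isT ltac:(lia).
    have a3 := hlt 2%N n ltac:(lia) ltac:(lia).
    have [//|a4] := ltnP 5 (p n); have e : p 2%N = 4%N by lia.
    by have := proj1 (hp 2%N ltac:(lia)); rewrite e.
  have [pz lz] := hp n ltac:(lia).
  have hs : settled (List.map N.of_nat (mkseq p n)) (N.of_nat (p n)).
    apply: decided2_settled.
    + by apply: in_primes100 => //; lia.
    + move/forallb_forall: all_decided2; apply; apply: not_small_prime30; last by lia.
      exact: in_primes30.
    + by apply: sorted_mkseq => i j hij hj; apply: hlt => //; exact: hnt.
    + by rewrite List.length_map -[List.length _]/(size _) size_mkseq; lia.
    + move=> x /in_mkseq [i hi ->]; have [pi li] := hp i (hnt i hi).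
      by split; [exact: in_primes30 | have := hlt i n hi ltac:(lia); lia].
  have := hasse_linear (linear_dichotomy (hs _ (le1000 _ hc))).
  apply: hasse_ext => a; rewrite size_mkseq; congr (_ - _).
  by apply: eq_big_nat => i /andP [_ hi]; rewrite nth_mkseq.
- move=> s c hperm hc; apply: hasse_products; first by rewrite (perm_size hperm).
  apply: product_dichotomy; last exact: le1000.
  apply: canonical_settled; move/allP: permutations_canonical; apply.
  by rewrite mem_permutations.
- have := hasse_linear (ps := [:: 2; 3; 5; 7; 11; 13; 17; 19]%N) (z := 23) (c := 55191)
    (linear_dichotomy (or_intror obstructed_55191)).
  by apply: hasse_ext => a /=; do 7!rewrite big_nat_recr //=; rewrite big_nat1.
Qed.
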